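(* Let $f$ be a measurable function on $\mathbb{R}^d$ supported in a closed ball $B \subsetneq \mathbb{R}^d$. Then $M(f) \in L_{\Psi}(B)$ if, and only if, $f \in L\log\log L(B)$.
   Context: The Hardy-Littlewood maximal function of $f$ is $M(f)(x) := \sup_{r>0} \frac{1}{|B(x,r)|}\int_{B(x,r)} |f(y)|\,dy \in [0,\infty]$, $x\in\mathbb{R}^d$, where $B(x,r)$ is the open ball with center $x$ and radius $r$, and $|A|$ denotes the Lebesgue measure of $A$. Let $\Psi:\mathbb{R}^d\times[0,\infty)\to[0,\infty)$ be given by $\Psi(x,t) := \dfrac{t}{\log(e+t)+\log(e+|x|)}$, with the convention $\Psi(x,\infty)=\infty$. For a measurable set $B\subseteq\mathbb{R}^d$, $L_\Psi(B)$ is the space of all measurable functions $g$ on $B$ such that $\int_B \Psi(x,|g(x)|)\,dx<\infty$. For a measurable set $B\subseteq\mathbb{R}^d$, $L\log\log L(B)$ is the class of all locally integrable functions $f$ on $\mathbb{R}^d$ with $\mathrm{supp}(f)\subseteq B$ and $\int_B |f(x)|\log^+\log^+|f(x)|\,dx<\infty$, where $\log^+ |x| = \max\{\log |x|,0\}$ (and $\log^+ 0=0$). *)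

(* Defs.v *)
From HB Require Import structures.
From mathcomp Require Import all_boot all_order all_algebra.
From mathcomp Require Import all_classical all_reals all_analysis.
From mathcomp Require Import measurable_realfun.

Set Implicit Arguments.
Unset Strict Implicit.
Unset Printing Implicit Defensive.
Import Order.TTheory GRing.Theory Num.Theory.
Import numFieldNormedType.Exports.

Local Open Scope classical_set_scope.
Local Open Scope ring_scope.

Section euclidean.
Context {R : realType} {d : nat}.
Implicit Types (x y : 'rV[R]_d) (r : R).

(* The library's norm on row vectors is the sup norm; it induces the same
   topology but not the same balls. *)
Definition enorm x : R := Num.sqrt (\sum_(i < d) x ord0 i ^+ 2).

Definition eball x r : set 'rV[R]_d := [set y | enorm (y - x) < r].

Definition eclosed_ball x r : set 'rV[R]_d := [set y | enorm (y - x) <= r].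

End euclidean.

Section lebesgue_outer.
Context {R : realType} {d : nat}.
Implicit Types (a b : 'rV[R]_d) (A : set 'rV[R]_d).
Local Open Scope ereal_scope.

Definition box a b : set 'rV[R]_d :=
  [set x | forall i, (a ord0 i <= x ord0 i <= b ord0 i)%R].

Definition box_volume a b : R :=
  (\prod_(i < d) Num.max (b ord0 i - a ord0 i) 0)%R.

(* The covers are countable, possibly finite, families of boxes (D is the set
   of indices in use). *)
Definition lebesgue_outer A : \bar R :=
  ereal_inf [set s | exists (D : set nat) (a b : nat -> 'rV[R]_d),
    A `<=` \bigcup_(k in D) box (a k) (b k) /\
    s = \esum_(k in D) (box_volume (a k) (b k))%:E].

Lemma box_volume_ge0 a b : (0 <= box_volume a b)%R.
Proof. by apply: prodr_ge0 => i _; rewrite le_max lexx orbT. Qed.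

Lemma lebesgue_outer_ge0 A : 0 <= lebesgue_outer A.
Proof.
apply: le_ereal_inf_tmp => _ [D [a [b [_ ->]]]].
by apply: esum_ge0 => k _; rewrite lee_fin box_volume_ge0.
Qed.

Lemma lebesgue_outer0 : lebesgue_outer set0 = 0.
Proof.
apply/eqP; rewrite eq_le lebesgue_outer_ge0 andbT.
apply: ereal_inf_lbound; exists set0, (fun=> 0%R), (fun=> 0%R).
by split; [exact: sub0set|rewrite esum_set0].
Qed.

Lemma le_lebesgue_outer :
  {homo lebesgue_outer : A B / A `<=` B >-> A <= B}.
Proof.
move=> A B AB; apply/ereal_inf_le_tmp => s [D [a [b [BD ->]]]].
by exists D, a, b; split => //; exact: subset_trans BD.
Qed.

Lemma lebesgue_outer_sigma_subadditive : sigma_subadditive lebesgue_outer.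
Proof.
move=> A; have [[i ioo]|] := pselect (exists i, lebesgue_outer (A i) = +oo).
  rewrite (eseries_pinfty _ _ ioo) ?leey// => n _.
  by rewrite -ltNye (lt_le_trans _ (lebesgue_outer_ge0 _)).
rewrite -forallNE => Aoo.
apply/lee_addgt0Pr => e e0.
rewrite (le_trans _ (epsilon_trick _ _ (ltW e0)))//; last first.
  by move=> n; exact: lebesgue_outer_ge0.
pose vol (c : nat -> 'rV[R]_d * 'rV[R]_d) k : \bar R :=
  (box_volume (c k).1 (c k).2)%:E.
have vol0 c k : 0 <= vol c k by rewrite lee_fin box_volume_ge0.
pose P n (c : set nat * (nat -> 'rV[R]_d * 'rV[R]_d)) :=
  A n `<=` \bigcup_(k in c.1) box (c.2 k).1 (c.2 k).2 /\
  \esum_(k in c.1) vol c.2 k <=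
    lebesgue_outer (A n) + (e / (2 ^ n.+1)%:R)%:E.
have [G PG] : {G & forall n, P n (G n)}.
  apply: (@choice _ _ P) => n.
  have en1 : (0 < e / (2 ^ n.+1)%:R)%R by rewrite divr_gt0// ltr0n expn_gt0.
  have Afin : lebesgue_outer (A n) \is a fin_num.
    by rewrite ge0_fin_numE ?lebesgue_outer_ge0// ltey; exact/eqP/Aoo.
  have [s [D [a [b [AD ->]]]] lts] := lb_ereal_inf_adherent en1 Afin.
  by exists (D, fun k => (a k, b k)); split => //=; exact/ltW.
pose J : set (nat * nat) := [set: nat] `*`` (fun n => (G n).1).
pose w (p : nat * nat) := vol (G p.1).2 p.2.
have /card_esym/ppcard_eqP[f] := card_nat2.
apply: (@le_trans _ _ (\esum_(p in J) w p)).
  apply: ereal_inf_lbound.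
  exists (f @^-1` J), (fun k => ((G (f k).1).2 (f k).2).1),
    (fun k => ((G (f k).1).2 (f k).2).2); split.
    move=> t [n _ /(PG n).1[j Dj tj]].
    have fK : f (f^-1%FUN (n, j)) = (n, j) by rewrite invK ?inE.
    by exists (f^-1%FUN (n, j)); rewrite /= fK.
  apply: (reindex_esum (f @^-1` J) J f); split=> //.
    by move=> i j _ _ fij; apply: (@inj _ _ _ f) => //; rewrite ?inE.
  move=> p Jp; exists (f^-1%FUN p); last by rewrite invK ?inE.
  by rewrite /= invK ?inE.
rewrite -(@esum_esum _ _ _ setT (fun n => (G n).1) (fun n k => vol (G n).2 k))//.
rewrite -nneseries_esumT//; last by move=> n; exact: esum_ge0.
by apply: lee_nneseries => [n _ _|n _]; [exact: esum_ge0|exact: (PG n).2].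
Qed.

HB.instance Definition _ := isOuterMeasure.Build R 'rV[R]_d lebesgue_outer
  lebesgue_outer0 lebesgue_outer_ge0 le_lebesgue_outer
  lebesgue_outer_sigma_subadditive.

End lebesgue_outer.

(* R^d with the sigma-algebra of Lebesgue measurable (Caratheodory) sets; the
   carrier is convertible to 'rV[R]_d. *)
Notation lebT R d := (caratheodory_type (@lebesgue_outer R d)).

Definition lebesgue {R : realType} {d : nat} : set (lebT R d) -> \bar R :=
  @lebesgue_outer R d.

HB.instance Definition _ (R : realType) (d : nat) :=
  isMeasure.Build _ (lebT R d) R (@lebesgue R d)
    lebesgue_outer0 lebesgue_outer_ge0
    (@caratheodory_measure_sigma_additive _ _ (@lebesgue_outer R d)).

Section spaces.
Context {R : realType} {d : nat}.
Implicit Types (x : 'rV[R]_d) (B : set 'rV[R]_d) (f : lebT R d -> R).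
Local Notation mu := (@lebesgue R d).
Local Open Scope ereal_scope.

Definition supp f : set 'rV[R]_d := closure [set x : 'rV[R]_d | f x != 0%R].

Definition maximal f x : \bar R :=
  ereal_sup [set (mu (eball x r))^-1 * \int[mu]_(y in eball x r) `|(f y)%:E|
            | r in [set r : R | (0 < r)%R]].

(* Only the values at t in [0, +oo] are meaningful. *)
Definition Psi x (t : \bar R) : \bar R :=
  if t is s%:E then
    (s / (ln (expR 1 + s) + ln (expR 1 + enorm x)))%:E
  else +oo.

Definition L_Psi B : set (lebT R d -> \bar R) :=
  [set g : lebT R d -> \bar R | measurable_fun (B : set (lebT R d)) g /\
    \int[mu]_(x in B) Psi x `|g x| < +oo].

Definition locally_integrable_rV f :=
  measurable_fun setT f /\
  forall K : set 'rV[R]_d, compact K -> \int[mu]_(x in K) `|(f x)%:E| < +oo.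

(* log^+ t for t >= 0; [ln 0 = 0] in the library, so log^+ 0 = 0. *)
Definition lnplus (t : R) : R := (Num.max (ln t) 0)%R.

Definition LloglogL B : set (lebT R d -> R) :=
  [set f : lebT R d -> R | [/\ locally_integrable_rV f, supp f `<=` B &
    \int[mu]_(x in B) (`|f x| * lnplus (lnplus `|f x|))%:E < +oo]].

End spaces.

(* Main.v *)
Require Import Defs.
From mathcomp Require Import all_boot all_order all_algebra.
From mathcomp Require Import all_classical all_reals all_analysis.
From mathcomp Require Import measurable_realfun.
From mathcomp Require Import ring lra.

(* Both directions are sharpened forms of the weak type (1,1) inequality for
   the maximal function, integrated over the levels e^k.

   Write L(t) = {|f| > t}, and call x a point of high average at level t if
   some cube centred at x of half-side s has mass int |f| > t s^d; up to
   dimensional constants this is M f(x) > t. With C, c depending only on d: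
   - t |{M f > t}| <= C int_{L(ct)} |f| (Vitali's covering lemma);
   - int_{L(t)} |f| <= C t |B n {M f > ct}| for all large t. Almost every point
     of L(t) has high average at level ct: otherwise the exceptional set,
     covered through Vitali inside an open set of at most twice its measure,
     would have too little mass. Choosing at each such point a nearly maximal
     cube, Vitali again bounds the mass by C t sum |Q_j| over disjoint cubes
     Q_j, on which M f is large; as Q_j is small and centred in B, a fixed
     proportion of it lies in B.
   Weighting the level t = e^k by e^k/(k+1) and summing, sum_{e^k < s} e^k/(k+1)
   is comparable to s/log(e+s), while sum_{e^k < s} 1/(k+1) is comparable to
   1 + log^+ log^+ s. *)

Set Implicit Arguments.
Unset Strict Implicit.
Unset Printing Implicit Defensive.
Import Order.TTheory GRing.Theory Num.Theory.
Import numFieldNormedType.Exports.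

Local Open Scope classical_set_scope.
Local Open Scope ring_scope.

(** * Boxes and Lebesgue outer measure *)

Section box_measure.
Context {R : realType} {d : nat}.
Implicit Types (a b x y : 'rV[R]_d) (A : set 'rV[R]_d).
Local Notation mu := (@lebesgue R d).

(** If [m] is the least and [M] the greatest element, there are at most [M - m + 1] elements, and
    [M - m <= v - u]. The [+ 1] becomes the error term of the lattice count below. *)
Lemma card_ord_itv (N : nat) (u v : R) :
  #|[set j : 'I_N | (u <= j%:R <= v)%R]%SET|%:R <= Num.max (v - u) 0 + 1.
Proof.
set S := [set j : 'I_N | _]%SET.
have [S0|[j0 j0S]] := set_0Vmem S.
  by rewrite S0 cards0 addr_ge0// le_max lexx orbT.
have [m mS mmin] := @arg_minnP _ j0 (mem S) (@nat_of_ord N) j0S.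
have [M MS mmax] := @arg_maxnP _ j0 (mem S) (@nat_of_ord N) j0S.
have mM : (m <= M)%N by exact: mmin.
have cS : (#|S| <= M - m + 1)%N.
  rewrite cardE -(size_map val) -(size_iota m (M - m + 1)).
  apply: uniq_leq_size; first by rewrite map_inj_uniq ?enum_uniq//; exact: val_inj.
  move=> _ /mapP[j + ->]; rewrite mem_enum => jS.
  rewrite mem_iota mmin//= addn1 addnS subnKC// ltnS.
  exact: mmax.
rewrite (@le_trans _ _ (M - m + 1)%:R)// ?ler_nat// natrD lerD2r natrB//.
move: mS MS; rewrite !inE => /andP[um _] /andP[_ Mv].
by rewrite le_max lerB.
Qed.

(** Lattice-point counting. Each of the [N.+1 ^ d] equally spaced points of the box lies in some
    covering box, and a covering box holds at most the product of its coordinate counts. After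
    rescaling, the [+ 1] of [card_ord_itv] widens each side by one lattice step. *)
Lemma box_volume_le_lattice (s : seq nat) (a b : 'rV[R]_d) (u v : nat -> 'rV[R]_d)
    (N : nat) :
  (forall i, a ord0 i < b ord0 i) ->
  (forall x, box a b x -> exists2 k, k \in s & box (u k) (v k) x) ->
  box_volume a b <= \sum_(k <- s) \prod_(i < d)
    (Num.max (v k ord0 i - u k ord0 i) 0 +
     (b ord0 i - a ord0 i) / N.+1%:R).
Proof.
move=> ab cov.
pose l i := b ord0 i - a ord0 i.
have l0 i : 0 < l i by rewrite subr_gt0.
pose p (j : {ffun 'I_d -> 'I_N.+1}) : 'rV[R]_d :=
  \row_i (a ord0 i + l i * ((j i)%:R / N.+1%:R)).
have pbox j : box a b (p j).
  move=> i; rewrite mxE lerDl mulr_ge0 ?divr_ge0 ?(ltW (l0 _))//=.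
  rewrite -lerBrDl -/(l i) ler_piMr// ?(ltW (l0 _))//.
  by rewrite ler_pdivrMr ?mul1r ?ler_nat ?ltr0n// ltnW.
pose S k := [set j : {ffun 'I_d -> 'I_N.+1} | `[< box (u k) (v k) (p j) >]]%SET.
pose T k i := [set j : 'I_N.+1 |
  ((u k ord0 i - a ord0 i) / l i * N.+1%:R <= j%:R <=
  (v k ord0 i - a ord0 i) / l i * N.+1%:R)%R]%SET.
have cardS k : (#|S k| <= \prod_(i < d) #|T k i|)%N.
  rewrite -(@big_enum _ _ _ _ predT (fun i => #|T k i|))/=.
  have := @card_family _ _ (fun i => mem (T k i)).
  rewrite foldrE big_map => <-; apply: subset_leq_card.
  apply/fintype.subsetP => j; rewrite inE => /asboolP bj.
  apply/familyP => i; rewrite inE.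
  have := bj i; rewrite mxE => /andP[h1 h2].
  have {}h1 : (u k ord0 i - a ord0 i) / l i <= (j i)%:R / N.+1%:R.
    by rewrite ler_pdivrMr// mulrC lerBlDl.
  have {}h2 : (j i)%:R / N.+1%:R <= (v k ord0 i - a ord0 i) / l i.
    by rewrite ler_pdivlMr// mulrC lerBrDl.
  by rewrite -ler_pdivlMr ?ltr0n// h1 -ler_pdivrMr ?ltr0n.
have cover : (N.+1 ^ d <= \sum_(k <- s) #|S k|)%N.
  have -> : (N.+1 ^ d)%N = #|{: {ffun 'I_d -> 'I_N.+1}}|.
    by rewrite card_ffun !card_ord.
  rewrite -cardsT.
  apply: (@leq_trans #|\bigcup_(k <- s) S k|).
    apply: subset_leq_card; apply/fintype.subsetP => j _.
    have [k ks kj] := cov _ (pbox j).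
    elim: (s) ks => // k' t ih; rewrite inE big_cons => /predU1P[<-|/ih jt].
      by rewrite 2!inE; apply/orP; left; apply/asboolP.
    by rewrite inE jt orbT.
  elim: (s) => [|k t ih]; first by rewrite !big_nil cards0.
  rewrite !big_cons (leq_trans (leq_card_setU _ _))//.
  by rewrite leq_add2l.
have bvE : box_volume a b = \prod_(i < d) l i.
  apply: eq_bigr => i _; apply/max_idPl.
  exact/ltW/l0.
have N0 : (0 : R) < N.+1%:R ^+ d by rewrite exprn_gt0// ltr0n.
have lp : 0 < \prod_(i < d) l i by apply: prodr_gt0.
rewrite bvE -(ler_pM2r N0) mulr_suml.
apply: (@le_trans _ _ (\prod_(i < d) l i * \sum_(k <- s) #|S k|%:R)).
  rewrite ler_pM2l// -natrX -natr_sum ler_nat//.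
rewrite mulr_sumr ler_sum// => k _.
apply: (@le_trans _ _ (\prod_(i < d) l i * (\prod_(i < d) #|T k i|)%:R)).
  by rewrite ler_pM2l// ler_nat.
have -> : (N.+1%:R : R) ^+ d = \prod_(i < d) N.+1%:R.
  by rewrite prodr_const card_ord.
rewrite natr_prod -!big_split/=.
apply: ler_prod => i _; rewrite mulr_ge0 ?(ltW (l0 _))//=.
have := card_ord_itv N.+1 ((u k ord0 i - a ord0 i) / l i * N.+1%:R)
  ((v k ord0 i - a ord0 i) / l i * N.+1%:R).
rewrite -/(T k i) => /(ler_wpM2l (ltW (l0 i)))/le_trans; apply.
have NN : (N.+1%:R : R) != 0 by rewrite pnatr_eq0.
rewrite -mulrBl -mulrBl opprB addrA addrNK -mulrA.
have -> : forall t : R, Num.max (t * ((l i)^-1 * N.+1%:R)) 0 = Num.max t 0 * ((l i)^-1 * N.+1%:R).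
  by move=> t; rewrite maxr_pMl ?mul0r// mulr_ge0// invr_ge0 ltW.
rewrite -/(l i) le_eqVlt; apply/orP; left; apply/eqP; field.
by rewrite addrC natr1 NN gt_eqF.
Qed.

(** The error of the lattice count vanishes as the mesh tends to 0. *)
Lemma box_volume_le_finite_cover (s : seq nat) a b (u v : nat -> 'rV[R]_d) :
  (forall i, a ord0 i < b ord0 i) ->
  (forall x, box a b x -> exists2 k, k \in s & box (u k) (v k) x) ->
  box_volume a b <= \sum_(k <- s) box_volume (u k) (v k).
Proof.
move=> ab cov.
pose h (N : nat) : R := \sum_(k <- s) \prod_(i < d)
    (Num.max (v k ord0 i - u k ord0 i) 0 +
     (b ord0 i - a ord0 i) / N.+1%:R).
have hcvg : h @ \oo --> \sum_(k <- s) box_volume (u k) (v k).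
  apply: cvg_big => [|k _]; first exact: add_continuous.
  apply: cvg_big => [|i _]; first exact: mul_continuous.
  rewrite -[X in _ --> X]addr0; apply: cvgD; first exact: cvg_cst.
  rewrite -[X in _ --> X](mulr0 (b ord0 i - a ord0 i)).
  apply: cvgMr; exact: cvg_harmonic.
rewrite -(cvg_lim _ hcvg)//; apply: limr_ge; first by apply/cvg_ex; eexists; exact: hcvg.
by apply: nearW => N; exact: box_volume_le_lattice.
Qed.

End box_measure.

(** * Volume of boxes, outer regularity and measurability of half-spaces *)

Section regularity.
Context {R : realType} {d : nat}.
Implicit Types (a b x y : 'rV[R]_d.+1) (A : set 'rV[R]_d.+1).
Local Notation mu := (@lebesgue R d.+1).

Definition open_box a b : set 'rV[R]_d.+1 :=
  [set x | forall i, a ord0 i < x ord0 i < b ord0 i].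

Lemma enlarge_box a b (e : R) : 0 < e ->
  exists ab : 'rV[R]_d.+1 * 'rV[R]_d.+1,
    [/\ (forall i, ab.1 ord0 i < ab.2 ord0 i), box a b `<=` open_box ab.1 ab.2
      & box_volume ab.1 ab.2 <= box_volume a b + e].
Proof.
move=> e0.
pose l (i : 'I_d.+1) := Num.max (b ord0 i - a ord0 i) 0.
have l0 i : 0 <= l i by rewrite le_max lexx orbT.
pose g (N : nat) : R := \prod_(i < d.+1) (l i + 2 * N.+1%:R^-1).
have gcvg : g @ \oo --> box_volume a b.
  apply: cvg_big => [|i _]; first exact: mul_continuous.
  rewrite -[X in _ --> X]addr0; apply: cvgD; first exact: cvg_cst.
  rewrite -[X in _ --> X](mulr0 2).
  by apply: cvgMr; exact: cvg_harmonic.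
have [N _ /(_ N (leqnn _))/= gN] : \forall N \near \oo, g N < box_volume a b + e.
  by apply: (cvgr_lt _ gcvg); rewrite ltrDl.
pose t : R := N.+1%:R^-1.
have t0 : 0 < t by rewrite invr_gt0 ltr0n.
(* The maximum keeps the enlarged box nondegenerate even when the given one is empty; in every case
   its sides are [l i + 2 * t]. *)
exists (\row_i (a ord0 i - t), \row_i (Num.max (a ord0 i) (b ord0 i) + t)).
have lE i : Num.max (a ord0 i) (b ord0 i) + t - (a ord0 i - t) = l i + 2 * t.
  rewrite /l; have [ab|ba] := leP (a ord0 i) (b ord0 i).
    by rewrite max_l ?subr_ge0//; ring.
  by rewrite max_r ?subr_le0 ?(ltW ba)//; ring.
split => [i|x xab i|].
- by rewrite !mxE -subr_gt0 lE ltr_wpDl// mulr_gt0.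
- have /andP[ax xb] := xab i; rewrite !mxE ltrBlDr (le_lt_trans ax) ?ltrDl//=.
  by rewrite (le_lt_trans xb)// (@le_lt_trans _ _ (Num.max (a ord0 i) (b ord0 i)))
    ?ltrDl// le_max lexx orbT.
- apply: le_trans (ltW gN); rewrite /box_volume le_eqVlt; apply/orP; left.
  apply/eqP/eq_bigr => i _; rewrite !mxE lE.
  by apply: max_l; rewrite addr_ge0// mulr_ge0// ltW.
Qed.

(** Positive dimension matters: an empty product would be 1. *)
Lemma box_volume0 : box_volume (0 : 'rV[R]_d.+1) 0 = 0.
Proof. by rewrite /box_volume big_ord_recl subrr maxxx mul0r. Qed.

(** Half of [e] pays for a nearly optimal cover, the other half is spread geometrically over the
    enlargements of its boxes. Indices outside [D] receive small open boxes around the origin, so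
    that all of [nat] serves as index set. *)
Lemma open_box_cover A (e : R) : (mu A < +oo)%E -> 0 < e ->
  exists c : nat -> 'rV[R]_d.+1 * 'rV[R]_d.+1,
    [/\ (forall k i, (c k).1 ord0 i < (c k).2 ord0 i),
      A `<=` \bigcup_k open_box (c k).1 (c k).2 &
      (\sum_(k <oo) (box_volume (c k).1 (c k).2)%:E <= mu A + e%:E)%E].
Proof.
move=> Aoo e0; have e20 : 0 < e / 2 by rewrite divr_gt0.
have Afin : mu A \is a fin_num by rewrite ge0_fin_numE// lebesgue_outer_ge0.
have [_ [D [a [b [AD ->]]]] lts] := lb_ereal_inf_adherent e20 Afin.
pose vol k : \bar R := if `[< D k >] then (box_volume (a k) (b k))%:E else 0%E.
have vol0 k : (0 <= vol k)%E.
  by rewrite /vol; case: ifPn => // _; rewrite lee_fin box_volume_ge0.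
have en k : 0 < e / 2 / (2 ^ k.+1)%:R by rewrite divr_gt0// ltr0n expn_gt0.
have /choice[c cP] : forall k, exists c : 'rV[R]_d.+1 * 'rV[R]_d.+1,
    [/\ (forall i, c.1 ord0 i < c.2 ord0 i),
      (D k -> box (a k) (b k) `<=` open_box c.1 c.2) &
      ((box_volume c.1 c.2)%:E <= vol k + (e / 2 / (2 ^ k.+1)%:R)%:E)%E].
  move=> k; rewrite /vol; case: asboolP => [Dk|nDk].
    by have [c [? ? ?]] := enlarge_box (a k) (b k) (en k); exists c; split.
  have [c [c12 _ cv]] := enlarge_box 0 0 (en k); exists c; split => //.
  by rewrite box_volume0 in cv; rewrite -EFinD lee_fin.
exists c; split.
- by move=> k; have [] := cP k.
- by move=> x /AD[k Dk xk]; exists k => //; have [_ + _] := cP k; exact.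
- apply: (@le_trans _ _ (\sum_(k <oo) (vol k + (e / 2 / (2 ^ k.+1)%:R)%:E))%E).
    apply: lee_nneseries => [k _ _|k _]; first by rewrite lee_fin box_volume_ge0.
    by have [] := cP k.
  rewrite (le_trans (epsilon_trick _ _ (ltW e20)))//.
  rewrite [e in leRHS]splitr EFinD addeA leeD2r// ltW//.
  rewrite (le_lt_trans _ lts)// nneseries_esumT// [in leRHS]esum_mkcond.
  apply: le_esum => k _; rewrite /vol; case: asboolP => Dk.
    by rewrite mem_set.
  by rewrite memNset.
Qed.

Lemma lebesgue_box_le a b : (mu (box a b) <= (box_volume a b)%:E)%E.
Proof.
apply: ereal_inf_lbound; exists [set 0%N], (fun=> a), (fun=> b); split.
  by move=> x xab; exists 0%N.
by rewrite esum_set1// lee_fin box_volume_ge0.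
Qed.

Lemma open_open_box a b : open (open_box a b).
Proof.
rewrite openE => x xab.
apply: (@filter_forall _ _ (fun (i : 'I_d.+1) (y : 'rV[R]_d.+1) =>
  a ord0 i < y ord0 i < b ord0 i : Prop) (nbhs x)) => i.
have /andP[ax xb] := xab i.
have oI : nbhs (x ord0 i) `]a ord0 i, b ord0 i[%classic.
  by apply: open_nbhs_nbhs; split; [exact: interval_open|rewrite /= in_itv/= ax].
have := @coord_continuous R 1 d.+1 ord0 i x _ oI.
change (nbhs x ((fun M : 'rV[R]_d.+1 => M ord0 i) @^-1` `]a ord0 i, b ord0 i[%classic) ->
  nbhs x [set y : 'rV[R]_d.+1 | a ord0 i < y ord0 i < b ord0 i]).
by apply: (@filterS _ (nbhs x)) => y; rewrite /= in_itv.
Qed.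

Lemma compact_box a b : compact (box a b).
Proof.
have := @rV_compact R d.+1 (fun i => `[a ord0 i, b ord0 i]%classic).
have -> : [set v : 'rV[R]_d.+1 | forall i, `[a ord0 i, b ord0 i]%classic (v ord0 i)]
    = box a b.
  by apply/seteqP; split => x h i; have := h i; rewrite /= in_itv.
by apply => i; exact: segment_compact.
Qed.

(** By compactness a nearly optimal open cover of the box has a finite subcover, to which the finite
    estimate applies. *)
Lemma lebesgue_box a b : (forall i, a ord0 i < b ord0 i) ->
  ((box_volume a b)%:E <= mu (box a b))%E.
Proof.
move=> ab.
apply/lee_addgt0Pr => e e0.
have boo : (mu (box a b) < +oo)%E.
  by rewrite (le_lt_trans (lebesgue_box_le _ _))// ltry.
have [c [_ cov ce]] := open_box_cover boo e0.
apply: le_trans ce.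
have cpt := @compact_box a b.
rewrite compact_cover in cpt.
have [|s _ scov] := cpt nat setT (fun k => open_box (c k).1 (c k).2) _ cov.
  by move=> k _; exact: open_open_box.
(* All indices of the subcover lie below [n], so a partial sum of the series already bounds the
   volume. *)
pose n := (\max_(k <- finmap.enum_fset s) k).+1.
apply: (@le_trans _ _ (\sum_(0 <= k < n) (box_volume (c k).1 (c k).2)%:E)%E); last first.
  by apply: nneseries_lim_ge => k _ _; rewrite lee_fin box_volume_ge0.
rewrite sumEFin lee_fin; apply: (box_volume_le_finite_cover ab) => x /scov[k ks kx].
exists k; last by move=> i; have /andP[h1 h2] := kx i; rewrite !ltW.
rewrite mem_index_iota/= ltnS.
exact: (@leq_bigmax_seq _ (finmap.enum_fset s) xpredT (fun k => k) k ks isT).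
Qed.

Lemma outer_regular A (e : R) : (mu A < +oo)%E -> 0 < e ->
  exists U : set 'rV[R]_d.+1, [/\ open U, A `<=` U & (mu U <= mu A + e%:E)%E].
Proof.
move=> Aoo e0; have [c [_ cov ce]] := open_box_cover Aoo e0.
exists (\bigcup_k open_box (c k).1 (c k).2); split => //.
  by apply: bigcup_open => k _; exact: open_open_box.
apply: le_trans ce.
apply: le_trans (lebesgue_outer_sigma_subadditive _) _.
apply: lee_nneseries => [k _ _|k _]; first exact: lebesgue_outer_ge0.
apply: le_trans (lebesgue_box_le _ _).
apply: le_lebesgue_outer => x xk i.
by have /andP[h1 h2] := xk i; rewrite !ltW.
Qed.

(** The hyperplane cuts every covering box into two boxes whose volumes add up exactly, so a cover
    of [X] splits into covers of both parts with the same total volume. *)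
Lemma caratheodory_halfspace (i : 'I_d.+1) (t : R) :
  measurable ([set x : 'rV[R]_d.+1 | x ord0 i <= t] : set (lebT R d.+1)).
Proof.
set H := [set x | _].
apply: (@le_caratheodory_measurable _ _ (@lebesgue_outer R d.+1)) => X.
apply: le_ereal_inf_tmp => _ [D [a [b [XD ->]]]].
pose b' k : 'rV[R]_d.+1 := \row_j (if j == i then Num.min (b k ord0 j) t else b k ord0 j).
pose a' k : 'rV[R]_d.+1 := \row_j (if j == i then Num.max (a k ord0 j) t else a k ord0 j).
have -> : \esum_(k in D) (box_volume (a k) (b k))%:E =
   (\esum_(k in D) (box_volume (a k) (b' k))%:E +
   \esum_(k in D) (box_volume (a' k) (b k))%:E)%E.
  rewrite -esumD; [|by move=> k _; rewrite lee_fin box_volume_ge0..].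
  apply: eq_esum => k _; rewrite -EFinD; congr EFin.
  rewrite /box_volume (bigD1 i)//= [in RHS](bigD1 i)//= [X in _ = _ + X](bigD1 i)//=.
  rewrite (eq_bigr (fun j => Num.max (b k ord0 j - a k ord0 j) 0)); last first.
    by [].
  rewrite [X in _ = _ * X + _](eq_bigr (fun j => Num.max (b k ord0 j - a k ord0 j) 0)); last first.
    by move=> j /negbTE ji; rewrite !mxE ji.
  rewrite [X in _ = _ + _ * X](eq_bigr (fun j => Num.max (b k ord0 j - a k ord0 j) 0)); last first.
    by move=> j /negbTE ji; rewrite !mxE ji.
  rewrite -mulrDl; congr (_ * _); rewrite !mxE eqxx.
  rewrite !maxElt !minElt; repeat case: ifPn; lra.
apply: leeD; apply: ereal_inf_lbound.
  exists D, a, b'; split => // x [/XD[k Dk xk] xt]; exists k => // j.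
  have /andP[h1 h2] := xk j; rewrite h1 mxE; case: eqP => // ->.
  by rewrite le_min xt andbT; have /andP[] := xk i.
exists D, a', b; split => // x [/XD[k Dk xk] /negP]; rewrite -ltNge => xt.
exists k => // j.
have /andP[h1 h2] := xk j; rewrite h2 mxE; case: eqP => [->|]; last by rewrite h1.
by rewrite ge_max (ltW xt)/= andbT; have /andP[-> _] := xk i.
Qed.

End regularity.

(** * Cubes and Vitali's covering lemma *)

Section cubes.
Context {R : realType} {d : nat}.
Implicit Types (x y z : 'rV[R]_d.+1) (r : R) (A U V : set 'rV[R]_d.+1).
Local Notation mu := (@lebesgue R d.+1).

(** The open sup-norm ball. Coverings use these cubes because their volume is read off from boxes;
    passing to Euclidean balls costs only dimensional constants. *)
Definition cube x r : set 'rV[R]_d.+1 :=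
  [set y | forall i, `|y ord0 i - x ord0 i| < r].

Lemma cube_center x r : 0 < r -> cube x r x.
Proof. by move=> r0 i; rewrite subrr normr0. Qed.

Lemma cube_sym x y r : cube x r y -> cube y r x.
Proof. by move=> xy i; rewrite distrC. Qed.

Lemma cube_triangle x y z r s : cube x r y -> cube y s z -> cube x (r + s) z.
Proof.
move=> xy yz i; rewrite -(subrKA (y ord0 i)) addrC (le_lt_trans (ler_normD _ _))//.
exact: ltrD.
Qed.

Lemma sub_cube x r s : r <= s -> cube x r `<=` cube x s.
Proof. by move=> rs y xy i; exact: lt_le_trans (xy i) rs. Qed.

Lemma cube_le0 x r : r <= 0 -> cube x r = set0.
Proof.
move=> r0; rewrite -subset0 => y /(_ ord0).
by rewrite ltNge (le_trans r0).
Qed.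

Lemma cubeE x r : cube x r = open_box (\row_i (x ord0 i - r)) (\row_i (x ord0 i + r)).
Proof.
apply/seteqP; split => y xy i; have := xy i.
  by rewrite !mxE distrC ltr_distlC.
by rewrite !mxE distrC ltr_distlC.
Qed.

Lemma open_cubeP U : open U <-> forall x, U x -> exists2 r, 0 < r & cube x r `<=` U.
Proof.
split.
  rewrite openE => oU x /oU/nbhs_ballP[r r0 xU]; exists r => // y xy.
  apply: xU; split => // i j; rewrite (ord1 i).
  by have := xy j; rewrite distrC.
move=> HU; rewrite openE => x /HU[r r0 xU].
apply/nbhs_ballP; exists r => //= y [_ xy]; apply: xU => i.
by have := xy ord0 i; rewrite distrC.
Qed.

Lemma open_cube x r : open (cube x r).
Proof. by rewrite cubeE; exact: open_open_box. Qed.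

Lemma measurable_open_box (a b : 'rV[R]_d.+1) :
  measurable (open_box a b : set (lebT R d.+1)).
Proof.
have mlt (i : 'I_d.+1) t : measurable ([set x : 'rV[R]_d.+1 | x ord0 i < t] : set (lebT R d.+1)).
  have -> : [set x : 'rV[R]_d.+1 | x ord0 i < t] =
      \bigcup_n [set x : 'rV[R]_d.+1 | x ord0 i <= t - n.+1%:R^-1].
    apply/seteqP; split => [x /= xt|x [n _ /=]]; last first.
      by move/le_lt_trans; apply; rewrite ltrBlDr ltrDl invr_gt0.
    have [n _ /(_ n (leqnn _))/= nt] := @near_infty_natSinv_lt R (PosNum (eq_ind_r is_true xt (subr_gt0 _ _))).
    by exists n => //=; rewrite lerBrDr addrC -lerBrDr ltW.
  by apply: bigcup_measurable => n _; exact: caratheodory_halfspace.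
have -> : open_box a b = \bigcap_(i in [set: 'I_d.+1])
    (~` [set x : 'rV[R]_d.+1 | x ord0 i <= a ord0 i] `&` [set x | x ord0 i < b ord0 i]).
  apply/seteqP; split => x h i => [_|].
    by have /andP[h1 h2] := h i; split => //=; apply/negP; rewrite -ltNge.
  by have [/= /negP] := h i I; rewrite -ltNge => -> ->.
apply: (@fin_bigcap_measurable _ (lebT R d.+1)) => // i _.
apply: measurableI; last exact: mlt.
by apply: measurableC; exact: caratheodory_halfspace.
Qed.

Lemma rat_point x r : 0 < r -> exists q : 'rV[rat]_d.+1, cube x r (\row_i ratr (q ord0 i)).
Proof.
move=> r0.
have /choice[q qP] : forall i, exists q : rat, `|ratr q - x ord0 i| < r.
  move=> i; have /rat_in_itvoo[q] : x ord0 i - r < x ord0 i + r.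
    by rewrite ltrBlDr -addrA ltrDl addr_gt0.
  by rewrite in_itv/= => qP; exists q; rewrite distrC ltr_distlC.
by exists (\row_i q i) => i; rewrite !mxE.
Qed.

(** An open set is the union of the countably many cubes with rational centre and radius
    [1 / (n + 1)] that it contains. *)
Lemma measurable_open U : open U -> measurable (U : set (lebT R d.+1)).
Proof.
move=> /open_cubeP oU.
pose F (qp : 'rV[rat]_d.+1 * nat) : set 'rV[R]_d.+1 :=
  let C := cube (\row_i ratr (qp.1 ord0 i)) qp.2.+1%:R^-1 in
  if `[< C `<=` U >] then C else set0.
have -> : U = \bigcup_qp F qp.
  apply/seteqP; split => [x Ux|x [qp _]]; last first.
    by rewrite /F; case: asboolP => [CU /CU//|_ []].
  have [r r0 xU] := oU _ Ux.
  (* A cube of radius below [r / 2] that contains [x] stays inside [cube x r]. *)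
  have r20 : 0 < r / 2 by rewrite divr_gt0.
  have [n _ /(_ n (leqnn _))/= nr] := @near_infty_natSinv_lt R (PosNum r20).
  have n0 : (0 : R) < n.+1%:R^-1 by rewrite invr_gt0.
  have [q xq] := rat_point x n0.
  exists (q, n) => //; rewrite /F/=; case: asboolP => [_|]; first exact: cube_sym.
  case=> y qy; apply: xU; apply: sub_cube (cube_triangle xq qy).
  by rewrite [leRHS]splitr lerD// ltW.
apply: (@countable_bigcupT_measurable _ (lebT R d.+1)) => [|qp].
  exact: countableP.
rewrite /F; case: ifPn => // _; rewrite cubeE; exact: measurable_open_box.
Qed.

Lemma measurable_cube x r : measurable (cube x r : set (lebT R d.+1)).
Proof. by apply: measurable_open; exact: open_cube. Qed.

Lemma measurable_closed A : closed A -> measurable (A : set (lebT R d.+1)).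
Proof.
move=> cA; rewrite -(setCK A).
by apply: measurableC; apply: measurable_open; exact: closed_openC.
Qed.

Lemma lebesgue_cube_le x r : 0 <= r -> (mu (cube x r) <= ((2 * r) ^+ d.+1)%:E)%E.
Proof.
move=> r0.
apply: (@le_trans _ _ (mu (box (\row_i (x ord0 i - r)) (\row_i (x ord0 i + r))))).
  by apply: le_lebesgue_outer; rewrite cubeE => y h i; have /andP[h1 h2] := h i; rewrite !ltW.
rewrite (le_trans (lebesgue_box_le _ _))// lee_fin /box_volume.
rewrite (eq_bigr (fun=> 2 * r)) => [|i _]; last first.
  by rewrite !mxE (_ : _ - _ = 2 * r); [rewrite max_l// mulr_ge0|ring].
by rewrite prodr_const card_ord.
Qed.

(** A closed box of side [r] inside the open cube suffices: losing a factor [2 ^ (d + 1)] avoids a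
    limit. *)
Lemma lebesgue_cube_ge x r : 0 <= r -> ((r ^+ d.+1)%:E <= mu (cube x r))%E.
Proof.
rewrite le_eqVlt => /predU1P[<-|r0].
  by rewrite expr0n/= lebesgue_outer_ge0.
apply: (@le_trans _ _ (mu (box (\row_i (x ord0 i - r / 2)) (\row_i (x ord0 i + r / 2))))).
  apply: le_trans (lebesgue_box _); last by move=> i; rewrite !mxE; lra.
  rewrite lee_fin /box_volume (eq_bigr (fun=> r)) => [|i _]; last first.
    by rewrite !mxE (_ : _ - _ = r); [rewrite max_l// ltW|field].
  by rewrite prodr_const card_ord.
apply: le_lebesgue_outer => y h i; have := h i; rewrite !mxE => /andP[h1 h2].
by rewrite ltr_norml; apply/andP; split; lra.
Qed.

(** Zorn's lemma gives a maximal disjoint family [G] such that every cube meets a member of at least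
    half its radius. The centre [z] is then within [rho z + rho y <= 3 * rho y] of the centre [y] of
    that member. Radius 0, that is an empty cube, pads the enumeration. *)
Lemma vitali_cover V (rho : 'rV[R]_d.+1 -> R) (M : R) :
  (forall x, V x -> 0 < rho x <= M) ->
  exists (c : nat -> 'rV[R]_d.+1) (s : nat -> R),
    [/\ (forall k, s k = 0 \/ V (c k) /\ s k = rho (c k)),
      trivIset setT (fun k => cube (c k) (s k)) &
      V `<=` \bigcup_k cube (c k) (3 * s k)].
Proof.
move=> rhoM.
pose meets x y := cube x (rho x) `&` cube y (rho y) !=set0.
have meetsC x y : meets x y -> meets y x by rewrite /meets setIC.
have meets_refl x : V x -> meets x x.
  by move=> /rhoM/andP[x0 _]; exists x; split; exact: cube_center.
(* The third clause only concerns cubes that already meet [G]; in this form it passes to unions of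
   chains. *)
pose P (G : set 'rV[R]_d.+1) := [/\ G `<=` V,
  (forall x y, G x -> G y -> meets x y -> x = y) &
  (forall z, V z -> (exists2 y, G y & meets z y) ->
    exists y, [/\ G y, meets z y & rho z <= 2 * rho y])].
have [|G [[GV Gdisj Gbig] Gmax]] := @Zorn_bigcup _ P.
  move=> F FP Ftot; split.
  - by move=> x [X FX Xx]; have [XV _ _] := FP _ FX; exact: XV.
  - move=> x y [X FX Xx] [Y FY Yy].
    have [XY|YX] := Ftot _ _ FX FY.
      by have [_ h _] := FP _ FY; apply: h => //; exact: XY.
    by have [_ h _] := FP _ FX; apply: h => //; exact: YX.
  - move=> z Vz [y [X FX Xy] zy]; have [_ _ h] := FP _ FX.
    have [|y' [? ? ?]] := h z Vz; first by exists y.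
    by exists y'; split => //; exists X.
have Gmeets z : V z -> exists2 y, G y & meets z y.
  move=> Vz; apply: contrapT => nz.
  (* If some cubes missed [G], one of them with more than half of the supremal radius could be
     added, against maximality. *)
  pose W := [set w | V w /\ ~ exists2 y, G y & meets w y].
  have hsW : has_sup (rho @` W).
    split; first by exists (rho z), z.
    by exists M => _ [w [Vw _] <-]; have /andP[] := rhoM _ Vw.
  have Wz : W z by [].
  have S0 : 0 < sup (rho @` W).
    have /andP[z0 _] := rhoM _ Vz; apply: (lt_le_trans z0).
    by apply: ub_le_sup; [exact: hsW.2|exists z].
  have [_ [w [Vw nw] <-] Sw] := sup_adherent (divr_gt0 S0 (ltr0Sn R 1)) hsW.
  have {}Sw : sup (rho @` W) <= 2 * rho w by move: Sw; lra.
  apply: (Gmax (G `|` [set w])).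
    split; first exact: subsetUl.
    move=> /(_ w (or_intror erefl)) Gw; apply: nw; exists w => //.
    exact: meets_refl.
  split.
  - by move=> x [/GV//|->].
  - move=> x y [Gx|->] [Gy|->]//; first exact: Gdisj.
      by move=> xw; exfalso; apply: nw; exists x => //; exact: meetsC.
    by move=> wy; exfalso; apply: nw; exists y.
  - move=> u Vu [y Gwy uy].
    have [uG|nuG] := pselect (exists2 y, G y & meets u y).
      by have [y' [? ? ?]] := Gbig _ Vu uG; exists y'; split => //; left.
    case: Gwy => [Gy|yw]; first by exfalso; apply: nuG; exists y.
    rewrite yw in uy; exists w; split => //; first by right.
    by apply: le_trans Sw; apply: ub_le_sup; [exact: hsW.2|exists u].
(* A rational point is chosen in each cube of [G]; by disjointness these points are distinct, so
   their codes enumerate [G]. *)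
have /choice[f fP] : forall x, exists q : 'rV[rat]_d.+1,
    G x -> cube x (rho x) (\row_i ratr (q ord0 i)).
  move=> x; have [Gx|nGx] := pselect (G x); last by exists 0.
  have /andP[x0 _] := rhoM _ (GV _ Gx).
  by have [q xq] := rat_point x x0; exists q.
pose Q k := [set x | G x /\ pickle (f x) = k].
pose c k := xget 0 (Q k).
pose s k : R := if `[< Q k (c k) >] then rho (c k) else 0.
exists c, s; split.
- move=> k; rewrite /s; case: asboolP => [[Gk _]|]; last by left.
  by right; split => //; exact: GV.
- move=> k l _ _; rewrite /s; case: asboolP => [[Gk fk]|_]; last first.
    by rewrite cube_le0// => -[x []].
  case: asboolP => [[Gl fl]|_]; last first.
    by rewrite [X in _ `&` X]cube_le0// => -[x []].
  by move=> /(Gdisj _ _ Gk Gl) ckl; rewrite -fk -fl ckl.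
- move=> z Vz.
  have [y [Gy [t [zt yt]] zy]] := Gbig _ Vz (Gmeets _ Vz).
  exists (pickle (f y)) => //.
  have [Gc fc] : Q (pickle (f y)) (c (pickle (f y))).
    by rewrite /c; case: xgetP => [x _ //|/(_ y)]; case.
  have cE : c (pickle (f y)) = y.
    apply: Gdisj => //; exists (\row_i ratr (f y ord0 i)); split; last exact: fP.
    by have := fP _ Gc; rewrite (pcan_inj pickleK fc).
  rewrite /s; case: asboolP => [_|[]//]; rewrite cE.
  apply: sub_cube (cube_triangle yt (cube_sym zt)).
  by lra.
Qed.

End cubes.

(** * Euclidean balls *)

Section euclidean_norm.
Context {R : realType} {d : nat}.
Implicit Types (x y z : 'rV[R]_d.+1) (r : R) (A : set 'rV[R]_d.+1).
Local Notation mu := (@lebesgue R d.+1).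
Local Notation K := (d.+2%:R : R).

Lemma enorm_ge0 x : 0 <= enorm x. Proof. exact: sqrtr_ge0. Qed.

Lemma enorm_sqr x : enorm x ^+ 2 = \sum_(i < d.+1) x ord0 i ^+ 2.
Proof. by rewrite sqr_sqrtr// sumr_ge0// => i _; exact: sqr_ge0. Qed.

Lemma coord_le_enorm x i : `|x ord0 i| <= enorm x.
Proof.
rewrite -(ler_pXn2r (ltn0Sn 1))// ?nnegrE ?enorm_ge0// enorm_sqr real_normK ?num_real//.
by rewrite (bigD1 i)//= lerDl sumr_ge0// => j _; exact: sqr_ge0.
Qed.

Lemma enorm_le x r : 0 <= r -> (forall i, `|x ord0 i| <= r) -> enorm x <= d.+1%:R * r.
Proof.
move=> r0 xr; rewrite -(ler_pXn2r (ltn0Sn 1))// ?nnegrE ?enorm_ge0 ?mulr_ge0//.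
rewrite enorm_sqr (@le_trans _ _ (\sum_(i < d.+1) r ^+ 2))//.
  by apply: ler_sum => i _; rewrite -(real_normK (num_real _)) ler_pXn2r// nnegrE.
rewrite sumr_const card_ord -[leLHS]mulr_natl exprMn ler_wpM2r ?sqr_ge0//.
by rewrite -natrX ler_nat -{1}(expn1 d.+1) leq_pexp2l.
Qed.

Lemma enormD x y : enorm (x + y) <= enorm x + enorm y.
Proof.
rewrite -(ler_pXn2r (ltn0Sn 1))// ?nnegrE ?addr_ge0 ?enorm_ge0//.
have xyE : enorm (x + y) ^+ 2 =
    enorm x ^+ 2 + 2 * (\sum_(i < d.+1) x ord0 i * y ord0 i) + enorm y ^+ 2.
  rewrite !enorm_sqr mulr_sumr -!big_split/=; apply: eq_bigr => i _.
  by rewrite mxE; ring.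
have CS : \sum_(i < d.+1) x ord0 i * y ord0 i <= enorm x * enorm y.
  have [x0|x0] := eqVneq (enorm x) 0.
    rewrite x0 mul0r big1// => i _; have := coord_le_enorm x i.
    by rewrite x0 normr_le0 => /eqP ->; rewrite mul0r.
  have [y0|y0] := eqVneq (enorm y) 0.
    rewrite y0 mulr0 big1// => i _; have := coord_le_enorm y i.
    by rewrite y0 normr_le0 => /eqP ->; rewrite mulr0.
  have xy0 : 0 < enorm x * enorm y.
    by rewrite mulr_gt0// lt_neqAle eq_sym ?x0 ?y0 enorm_ge0.
  rewrite -(ler_pM2l xy0).
  (* The sum equals [2 |x| |y| (|x| |y| - <x, y>)], which gives the Cauchy-Schwarz inequality. *)
  have : 0 <= \sum_(i < d.+1) (enorm y * x ord0 i - enorm x * y ord0 i) ^+ 2.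
    by apply: sumr_ge0 => i _; exact: sqr_ge0.
  have -> : \sum_(i < d.+1) (enorm y * x ord0 i - enorm x * y ord0 i) ^+ 2 =
      enorm y ^+ 2 * (\sum_(i < d.+1) x ord0 i ^+ 2) -
      2 * (enorm x * enorm y * (\sum_(i < d.+1) x ord0 i * y ord0 i)) +
      enorm x ^+ 2 * (\sum_(i < d.+1) y ord0 i ^+ 2).
    rewrite !mulr_sumr -sumrN -!big_split/=.
    by apply: eq_bigr => i _; ring.
  rewrite -!enorm_sqr.
  lra.
rewrite xyE; lra.
Qed.

Lemma enormN x : enorm (- x) = enorm x.
Proof. by congr Num.sqrt; apply: eq_bigr => i _; rewrite mxE sqrrN. Qed.

Lemma enormZ (c : R) x : 0 <= c -> enorm (c *: x) = c * enorm x.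
Proof.
move=> c0; rewrite /enorm.
have -> : \sum_(i < d.+1) (c *: x) ord0 i ^+ 2 = c ^+ 2 * \sum_(i < d.+1) x ord0 i ^+ 2.
  by rewrite mulr_sumr; apply: eq_bigr => i _; rewrite mxE exprMn.
by rewrite sqrtrM ?sqr_ge0// sqrtr_sqr ger0_norm.
Qed.

Lemma eball_sub_cube x r : eball x r `<=` cube x r.
Proof.
move=> y /= xy i; apply: le_lt_trans xy.
by have := coord_le_enorm (y - x) i; rewrite !mxE.
Qed.

(** [K] exceeds the dimension by one, which makes the crude bound [enorm_le] strict. *)
Lemma cube_sub_eball x r : 0 < r -> cube x r `<=` eball x (K * r).
Proof.
move=> r0 y xy; rewrite /eball/= (@le_lt_trans _ _ (d.+1%:R * r))//.
  by apply: enorm_le => [|i]; [exact: ltW|rewrite !mxE ltW].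
by rewrite ltr_pM2r// ltr_nat.
Qed.

Lemma open_eball x r : open (eball x r).
Proof.
apply/open_cubeP => y xy.
have e0 : 0 < r - enorm (y - x) by rewrite subr_gt0.
exists ((r - enorm (y - x)) / K); first by rewrite divr_gt0.
move=> z /(cube_sub_eball (divr_gt0 e0 (ltr0Sn _ _))).
rewrite mulrC divfK ?pnatr_eq0// /eball/= => yz.
rewrite -(subrKA y) addrC (le_lt_trans (enormD _ _))//.
by rewrite -ltrBrDl.
Qed.

Lemma closed_eclosed_ball x r : closed (eclosed_ball x r).
Proof.
rewrite -(setCK (eclosed_ball x r)); apply: open_closedC; apply/open_cubeP => y.
rewrite /eclosed_ball/= => /negP; rewrite -ltNge => xy.
have e0 : 0 < enorm (y - x) - r by rewrite subr_gt0.
exists ((enorm (y - x) - r) / K); first by rewrite divr_gt0.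
move=> z /(cube_sub_eball (divr_gt0 e0 (ltr0Sn _ _))).
rewrite mulrC divfK ?pnatr_eq0// /eball/= => yz.
apply/negP; rewrite -ltNge.
have := enormD (z - x) (y - z); rewrite addrC subrKA.
rewrite -[enorm (y - z)]enormN opprB; lra.
Qed.

Lemma measurable_eball x r : measurable (eball x r : set (lebT R d.+1)).
Proof. by apply: measurable_open; exact: open_eball. Qed.

Lemma measurable_eclosed_ball x r : measurable (eclosed_ball x r : set (lebT R d.+1)).
Proof. by apply: measurable_closed; exact: closed_eclosed_ball. Qed.

Lemma lebesgue_eball_le x r : 0 <= r -> (mu (eball x r) <= ((2 * r) ^+ d.+1)%:E)%E.
Proof.
move=> r0; apply: le_trans (lebesgue_cube_le x r0).
by apply: le_lebesgue_outer; exact: eball_sub_cube.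
Qed.

Lemma lebesgue_eball_ge x r : 0 < r -> (((r / K) ^+ d.+1)%:E <= mu (eball x r))%E.
Proof.
move=> r0; have rK : 0 < r / K by rewrite divr_gt0.
apply: le_trans (lebesgue_cube_ge x (ltW rK)) _.
apply: le_lebesgue_outer; apply: subset_trans (cube_sub_eball rK) _.
by rewrite mulrC divfK// pnatr_eq0.
Qed.

Lemma lebesgue_translate_le x A : (mu [set y : 'rV[R]_d.+1 | A (y - x)%R] <= mu A)%E.
Proof.
apply: le_ereal_inf_tmp => _ [D [a [b [AD ->]]]].
apply: ereal_inf_lbound; exists D, (fun k => a k + x), (fun k => b k + x); split.
  move=> y /AD[k Dk yk]; exists k => // i.
  by have := yk i; rewrite !mxE lerBrDr lerBlDr.
apply: eq_esum => k _; congr EFin; apply: eq_bigr => i _; rewrite !mxE.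
by congr Num.max; ring.
Qed.

(** Averages over balls of equal radius thus have the same normalisation at all centres, as the
    openness of [maximal f > t] requires. *)
Lemma lebesgue_eball_translate x y r : mu (eball x r) = mu (eball y r).
Proof.
have h u v : (mu (eball u r) <= mu (eball v r))%E.
  apply: le_trans (lebesgue_translate_le (u - v) (eball v r)).
  apply: le_lebesgue_outer => z; rewrite /eball/=.
  by rewrite opprB addrA addrAC addrK.
by apply/eqP; rewrite eq_le !h.
Qed.

End euclidean_norm.

(** * High averages and the maximal function *)

Section nonneg_integral.
Context {disp} {T : measurableType disp} {R : realType} (mu : {measure set T -> \bar R}).
Variable g : T -> \bar R.
Hypothesis mg : measurable_fun setT g.
Hypothesis g0 : forall x, (0 <= g x)%E.
Local Notation I A := (\int[mu]_(x in A) g x)%E.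

Lemma le_integral_sub (A B : set T) : measurable A -> measurable B -> A `<=` B ->
  (I A <= I B)%E.
Proof. by move=> mA mB; apply: ge0_subset_integral => //; exact: measurable_funTS. Qed.

Lemma le_integral_cover (A : set T) (F : (set T)^nat) : measurable A ->
  (forall k, measurable (F k)) -> A `<=` \bigcup_k F k ->
  (I A <= \sum_(k <oo) I (F k))%E.
Proof.
move=> mA mF AF.
have mU : measurable (\bigcup_k F k) by exact: bigcupT_measurable.
have mS k : measurable (seqDU F k) by apply: measurableD => //; exact: bigsetU_measurable.
apply: (le_trans (le_integral_sub mA mU AF)).
rewrite seqDU_bigcup_eq ge0_integral_bigcup//; last exact: measurable_funTS.
apply: lee_nneseries => [k _ _|k _]; first exact: integral_ge0.
by apply: le_integral_sub => //; exact: subDsetl.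
Qed.

Lemma le_integral_disjoint (A : set T) (F : (set T)^nat) : measurable A ->
  (forall k, measurable (F k)) -> trivIset setT F -> \bigcup_k F k `<=` A ->
  (\sum_(k <oo) I (F k) <= I A)%E.
Proof.
move=> mA mF tF FA; rewrite -ge0_integral_bigcup//; last exact: measurable_funTS.
by apply: le_integral_sub => //; exact: bigcupT_measurable.
Qed.

(** Monotone convergence read backwards; it serves to shrink a cube or ball slightly while keeping a
    strict lower bound on its mass. *)
Lemma lt_integral_bigcup (F : (set T)^nat) (c : \bar R) :
  nondecreasing_seq F -> (forall k, measurable (F k)) ->
  (c < I (\bigcup_k F k))%E -> exists k, (c < I (F k))%E.
Proof.
move=> ndF mF cF; apply: contrapT => /forallNP h.
have cvgI := @ge0_nondecreasing_set_cvg_integral _ _ _ F g mu ndF mF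
   (fun i => measurable_funTS mg) (fun i x _ => g0 x).
move: cF; rewrite ltNge => /negP; apply.
rewrite -(cvg_lim _ cvgI)//; apply: lime_le; first by apply/cvg_ex; eexists; exact: cvgI.
by apply: nearW => k; rewrite leNgt; apply/negP; exact: h.
Qed.

Lemma le_measure_disjoint (A : set T) (F : (set T)^nat) : measurable A ->
  (forall k, measurable (F k)) -> trivIset setT F -> \bigcup_k F k `<=` A ->
  (\sum_(k <oo) mu (F k) <= mu A)%E.
Proof.
move=> mA mF tF FA; rewrite -measure_semi_bigcup//; last exact: bigcupT_measurable.
by apply: le_measure => //; rewrite inE//; exact: bigcupT_measurable.
Qed.

End nonneg_integral.

(** * High averages over cubes compared with superlevel sets of the maximal function *)

Section high_averages.
Context {R : realType} {d : nat}.
Implicit Types (x y : 'rV[R]_d.+1) (t r : R).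
Local Notation mu := (@lebesgue R d.+1).
Local Notation K := (d.+2%:R : R).
Local Notation D := d.+1.
Variable f : lebT R d.+1 -> R.
Hypothesis mf : measurable_fun setT f.

Definition mass (A : set 'rV[R]_d.+1) : \bar R :=
  (\int[mu]_(x in (A : set (lebT R d.+1))) `|(f x)%:E|)%E.

Lemma measurable_abs_fun :
  measurable_fun setT (fun x : lebT R d.+1 => `|(f x)%:E|%E).
Proof. by apply: measurableT_comp => //; exact/measurable_EFinP. Qed.

Definition high_avg t : set 'rV[R]_d.+1 :=
  [set x | exists2 r, 0 < r & ((t * r ^+ D)%:E < mass (cube x r))%E].

Lemma mass_ge0 A : (0 <= mass A)%E.
Proof. by apply: integral_ge0 => x _; exact: abse_ge0. Qed.

Lemma mass_sub (A B : set 'rV[R]_d.+1) : measurable (A : set (lebT R d.+1)) ->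
  measurable (B : set (lebT R d.+1)) -> A `<=` B -> (mass A <= mass B)%E.
Proof. by apply: le_integral_sub; [exact: measurable_abs_fun|]. Qed.

(** A slightly smaller concentric cube still has enough mass, and it is contained in the cubes of
    the original radius around all nearby centres. *)
Lemma open_high_avg t : open (high_avg t).
Proof.
apply/open_cubeP => x [r r0 rx].
pose F n := cube x (r - n.+1%:R^-1).
have FE : cube x r = \bigcup_n F n.
  apply/seteqP; split => [y xy|y [n _]]; last first.
    by apply: sub_cube; rewrite gerBl.
  have : \forall n \near \oo, forall i : 'I_d.+1, `|y ord0 i - x ord0 i| < r - n.+1%:R^-1.
    apply: filter_forall => i.
    have yx0 : 0 < r - `|y ord0 i - x ord0 i| by rewrite subr_gt0.
    have := @near_infty_natSinv_lt R (PosNum yx0); apply: filterS => n /=.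
    by rewrite ltrBrDr -ltrBrDl.
  by move=> [n _ /(_ n (leqnn _)) h]; exists n.
have ndF : nondecreasing_seq F.
  apply/nondecreasing_seqP => n; apply/subsetPset; apply: sub_cube.
  by rewrite lerB// lef_pV2 ?posrE// ler_nat.
have [n nx] : exists n, ((t * r ^+ D)%:E < mass (F n))%E.
  apply: lt_integral_bigcup => //.
  - exact: measurable_abs_fun.
  - by move=> k; exact: measurable_cube.
  - by rewrite -FE.
have n0 : (0 : R) < n.+1%:R^-1 by rewrite invr_gt0.
exists (n.+1%:R^-1) => // y xy; exists r => //; apply: (lt_le_trans nx).
apply: mass_sub; [exact: measurable_cube..|].
move=> z xz; have := cube_triangle (cube_sym xy) xz.
by rewrite addrC subrK.
Qed.

Lemma measurable_high_avg t : measurable (high_avg t : set (lebT R d.+1)).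
Proof. by apply: measurable_open; exact: open_high_avg. Qed.

Lemma lebesgue_eball x r : 0 < r -> exists2 m : R, mu (eball x r) = m%:E &
  (r / K) ^+ D <= m <= (2 * r) ^+ D.
Proof.
move=> r0; have h1 := lebesgue_eball_ge x r0; have h2 := lebesgue_eball_le x (ltW r0).
have fin : mu (eball x r) \is a fin_num.
  by rewrite ge0_fin_numE ?lebesgue_outer_ge0// (le_lt_trans h2)// ltry.
exists (fine (mu (eball x r))); first by rewrite fineK.
by rewrite -!lee_fin fineK// h1.
Qed.

Lemma eball_average_gt t x r (m : R) : 0 < r -> mu (eball x r) = m%:E ->
  (t%:E < (mu (eball x r))^-1 * mass (eball x r))%E = ((t * m)%:E < mass (eball x r))%E.
Proof.
move=> r0 xm; have [m' xm' /andP[m1 m2]] := lebesgue_eball x r0.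
have m0 : 0 < m.
  move: xm'; rewrite xm => -[->]; apply: lt_le_trans m1.
  by rewrite exprn_gt0// divr_gt0.
by rewrite xm inver gt_eqF// lte_pdivlMl// -EFinM mulrC.
Qed.

Lemma maximal_gtP t x : (t%:E < maximal f x)%E <->
  exists2 r, 0 < r & (t%:E < (mu (eball x r))^-1 * mass (eball x r))%E.
Proof.
split => [|[r r0 tr]]; last first.
  by apply: (lt_le_trans tr); apply: ereal_sup_ubound; exists r.
move=> tM; apply: contrapT => h; move: tM; rewrite ltNge => /negP; apply.
apply: ge_ereal_sup => _ [r r0 <-]; rewrite leNgt; apply/negP => tr.
by apply: h; exists r.
Qed.

(** The cube of half-side [r] lies in the ball of radius [K * r], whose measure is at most
    [(2 * K * r) ^ D]. *)
Lemma high_avg_maximal t x : 0 <= t -> high_avg (t * (2 * K) ^+ D) x ->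
  (t%:E < maximal f x)%E.
Proof.
move=> t0 [r r0 xr]; have Kr : 0 < K * r by rewrite mulr_gt0.
apply/maximal_gtP; exists (K * r) => //.
have [m xm /andP[_ m2]] := lebesgue_eball x Kr.
rewrite (eball_average_gt t Kr xm).
apply: (@lt_le_trans _ _ (mass (cube x r))); last first.
  apply: mass_sub; [exact: measurable_cube|exact: measurable_eball|].
  exact: cube_sub_eball.
apply: le_lt_trans xr; rewrite lee_fin -mulrA -exprMn -mulrA.
by rewrite ler_wpM2l.
Qed.

(** The ball of radius [r] lies in the cube of half-side [r] and has measure at least
    [(r / K) ^ D]. *)
Lemma maximal_high_avg t x : 0 <= t -> (t%:E < maximal f x)%E ->
  high_avg (t / K ^+ D) x.
Proof.
move=> t0 /maximal_gtP[r r0].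
have [m xm /andP[m1 _]] := lebesgue_eball x r0.
rewrite (eball_average_gt t r0 xm) => xr; exists r => //.
apply: (@lt_le_trans _ _ (mass (eball x r))); last first.
  apply: mass_sub; [exact: measurable_eball|exact: measurable_cube|].
  exact: eball_sub_cube.
apply: le_lt_trans xr; rewrite lee_fin -mulrA ler_wpM2l//.
by apply: le_trans m1; rewrite expr_div_n mulrC.
Qed.

Lemma maximal_ge0 x : (0 <= maximal f x)%E.
Proof.
apply: (@le_trans _ _ ((mu (eball x 1))^-1 * mass (eball x 1))%E).
  by rewrite mule_ge0 ?mass_ge0// inve_ge0 lebesgue_outer_ge0.
by apply: ereal_sup_ubound; exists 1 => //=.
Qed.

(** Lower semicontinuity of the maximal function, by the shrinking argument of [open_high_avg]
    applied to balls. *)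
Lemma open_maximal_gt t : open [set x | (t%:E < maximal f x)%E].
Proof.
apply/open_cubeP => x /= /maximal_gtP[r r0].
have [m xm _] := lebesgue_eball x r0.
rewrite (eball_average_gt t r0 xm) => rx.
pose F n := eball x (r - n.+1%:R^-1).
have FE : eball x r = \bigcup_n F n.
  apply/seteqP; split => [y xy|y [n _]]; last first.
    by rewrite /F /eball/= => /lt_le_trans; apply; rewrite gerBl.
  have yx0 : 0 < r - enorm (y - x) by rewrite subr_gt0.
  have [n _ /(_ n (leqnn _)) /=] := @near_infty_natSinv_lt R (PosNum yx0).
  by rewrite ltrBrDr -ltrBrDl => h; exists n.
have ndF : nondecreasing_seq F.
  apply/nondecreasing_seqP => n; apply/subsetPset => y; rewrite /F /eball/=.
  by move/lt_le_trans; apply; rewrite lerB// lef_pV2 ?posrE// ler_nat.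
have [n nx] : exists n, ((t * m)%:E < mass (F n))%E.
  apply: lt_integral_bigcup => //.
  - exact: measurable_abs_fun.
  - by move=> k; exact: measurable_eball.
  - by rewrite -FE.
have n0 : (0 : R) < n.+1%:R^-1 / K by rewrite divr_gt0.
exists (n.+1%:R^-1 / K) => // y xy; apply/maximal_gtP; exists r => //.
rewrite (eball_average_gt t r0 (etrans (lebesgue_eball_translate y x r) xm)).
apply: (lt_le_trans nx).
apply: mass_sub; [exact: measurable_eball..|].
have := cube_sub_eball n0 xy; rewrite mulrC divfK ?pnatr_eq0// /eball/= => {}xy.
move=> z; rewrite /F /eball/= => xz.
rewrite -(subrKA x) (le_lt_trans (enormD _ _))// -[enorm (x - y)]enormN opprB.
by rewrite -[ltRHS](subrK n.+1%:R^-1) ltrD.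
Qed.

Lemma measurable_maximal (B : set (lebT R d.+1)) :
  measurable_fun B (maximal f : lebT R d.+1 -> \bar R).
Proof.
apply: measurable_funTS; apply: (measurability _ (ErealGenOInfty.measurableE R)) => //.
move=> _ [_ [t ->] <-]; rewrite setTI.
rewrite [X in measurable X](_ : _ = [set x | (t%:E < maximal f x)%E]).
  exact: measurable_open (@open_maximal_gt t).
by apply/seteqP; split => x /=; rewrite in_itv/= andbT.
Qed.

End high_averages.

(** * Weak type inequalities *)

Section weak_type.
Context {R : realType} {d : nat}.
Implicit Types (x y : 'rV[R]_d.+1) (t r : R).
Local Notation mu := (@lebesgue R d.+1).
Local Notation K := (d.+2%:R : R).
Local Notation D := d.+1.
Variable f : lebT R d.+1 -> R.
Hypothesis mf : measurable_fun setT f.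

Definition level t : set 'rV[R]_d.+1 := [set x | t < `|f x|].

Lemma measurable_level t : measurable (level t : set (lebT R d.+1)).
Proof.
have := @emeasurable_fun_o_infty _ _ _ _ _ measurableT (measurable_abs_fun mf) t%:E.
by rewrite setTI.
Qed.

Lemma mass_ge_level (A : set (lebT R d.+1)) t : measurable A -> 0 <= t -> A `<=` level t ->
  (t%:E * mu A <= mass f A)%E.
Proof.
move=> mA t0 At; rewrite -integral_cst//; apply: ge0_le_integral => //.
- by apply: measurable_funTS; exact: measurable_abs_fun.
- by move=> x /At; rewrite lee_fin => /ltW.
Qed.

Lemma mass_le_level (A : set (lebT R d.+1)) t : measurable A ->
  (forall x, A x -> `|f x| <= t) -> (mass f A <= t%:E * mu A)%E.
Proof.
move=> mA At; rewrite -integral_cst//; apply: ge0_le_integral => //.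
- by apply: measurable_funTS; exact: measurable_abs_fun.
Qed.

Lemma mass_set0 : mass f set0 = 0.
Proof. exact: integral_set0. Qed.

(** Where [|f| <= t / 2 ^ (D + 1)], the cube of volume at most [(2 r) ^ D] carries mass at most
    [t / 2 * r ^ D]; the rest must come from the level set. The case [r = 0] serves the empty cubes
    of [vitali_cover]. *)
Lemma weak_type_local x t r : 0 < t -> 0 <= r ->
  (r = 0 \/ ((t * r ^+ D)%:E < mass f (cube x r))%E) ->
  ((t / 2 * r ^+ D)%:E <= mass f (cube x r `&` level (t / 2 ^+ d.+2)))%E.
Proof.
move=> t0 r0 [->|]; first by rewrite expr0n/= mulr0 mass_ge0.
set L := level _ => xr.
have mQ := measurable_cube x r.
have mL : measurable (L : set (lebT R d.+1)) by exact: measurable_level.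
have QE : mass f (cube x r) = (mass f (cube x r `&` L) + mass f (cube x r `\` L))%E.
  rewrite /mass -ge0_integral_setU//; [|exact: measurableI|exact: measurableD|..].
  - by rewrite setUIDK.
  - by apply: measurable_funTS; exact: measurable_abs_fun.
  - by rewrite disj_set2E; apply/eqP; rewrite setDE setIACA setICr setI0.
have small : (mass f (cube x r `\` L) <= (t / 2 * r ^+ D)%:E)%E.
  apply: (@le_trans _ _ ((t / 2 ^+ d.+2)%:E * mu (cube x r `\` L))%E).
    apply: mass_le_level; first exact: measurableD.
    by move=> y [_ /negP]; rewrite -leNgt.
  apply: (@le_trans _ _ ((t / 2 ^+ d.+2)%:E * ((2 * r) ^+ D)%:E)%E).
    rewrite lee_wpmul2l ?lee_fin ?divr_ge0 ?(ltW t0)//.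
    apply: le_trans (lebesgue_cube_le x r0).
    by apply: le_lebesgue_outer; exact: subDsetl.
  rewrite -EFinM lee_fin exprMn mulrA exprS invfM.
  by rewrite -!mulrA (mulrA (2 ^+ D)^-1) mulVf ?mul1r// expf_neq0.
have : ((t * r ^+ D)%:E <= mass f (cube x r `&` L) + (t / 2 * r ^+ D)%:E)%E.
  by rewrite (le_trans (ltW xr))// QE leeD2l.
rewrite -leeBlDr// -EFinB; apply: le_trans; rewrite lee_fin.
by rewrite {2}[t]splitr mulrDl addrK.
Qed.

Hypothesis fin_mass : (mass f setT < +oo)%E.
Local Notation N := (fine (mass f setT)).

Lemma mass_le_fin (A : set (lebT R d.+1)) : measurable A -> (mass f A <= N%:E)%E.
Proof.
move=> mA; rewrite fineK ?ge0_fin_numE ?mass_ge0//.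
by apply: mass_sub.
Qed.

(** Finite total mass bounds the radii, as Vitali's lemma requires: if [r > 1], then
    [t * r <= t * r ^ D <= N]. *)
Lemma high_radius_le t x r : 0 < t -> 0 < r -> ((t * r ^+ D)%:E < mass f (cube x r))%E ->
  r <= Num.max 1 (N / t).
Proof.
move=> t0 r0 /lt_le_trans/(_ (mass_le_fin (measurable_cube x r))).
rewrite lte_fin => h; rewrite le_max; have [//|r1/=] := leP r 1.
rewrite ler_pdivlMr// mulrC (le_trans _ (ltW h))// ler_pM2l//.
by rewrite exprS ler_peMr ?(ltW r0)// exprn_ege1// ltW.
Qed.

(** Vitali's lemma is applied to the cubes witnessing the high averages: [6 ^ D] bounds the volume
    of the tripled cubes, and [2] is the loss in [weak_type_local]. *)
Lemma weak_type t : 0 < t ->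
  (t%:E * mu (high_avg f t) <= (2 * 6 ^+ D)%:E * mass f (level (t / 2 ^+ d.+2)))%E.
Proof.
move=> t0.
have /choice[rho rhoP] : forall x, exists r, high_avg f t x ->
    0 < r /\ ((t * r ^+ D)%:E < mass f (cube x r))%E.
  move=> x; have [[r r0 xr]|nx] := pselect (high_avg f t x); first by exists r.
  by exists 0.
have [|c [s [sP sdisj scov]]] := @vitali_cover _ _ (high_avg f t) rho (Num.max 1 (N / t)).
  by move=> x /rhoP[r0 xr]; rewrite r0/=; exact: high_radius_le xr.
have s0 k : 0 <= s k by case: (sP k) => [->//|[/rhoP[/ltW ? _] ->]].
set L := level _.
have mL : measurable (L : set (lebT R d.+1)) by exact: measurable_level.
have mQ k : measurable (cube (c k) (s k) `&` L : set (lebT R d.+1)).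
  by apply: measurableI => //; exact: measurable_cube.
apply: (@le_trans _ _ (t%:E * \sum_(k <oo) ((6 ^+ D)%:E * (s k ^+ D)%:E))%E).
  rewrite lee_wpmul2l ?lee_fin ?(ltW t0)//.
  apply: (@le_trans _ _ (\sum_(k <oo) mu (cube (c k) (3 * s k)))%E).
    apply: le_trans (le_lebesgue_outer scov) _.
    exact: lebesgue_outer_sigma_subadditive.
  apply: lee_nneseries => [k _ _|k _]; first exact: lebesgue_outer_ge0.
  rewrite (le_trans (lebesgue_cube_le _ _))// ?mulr_ge0//.
  by rewrite -EFinM lee_fin -exprMn mulrA -natrM.
rewrite nneseriesZl; last by move=> k _; rewrite lee_fin exprn_ge0.
rewrite muleA -EFinM (_ : t * 6 ^+ D = 2 * 6 ^+ D * (t / 2)); last by field.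
rewrite (EFinM (2 * 6 ^+ D) (t / 2)) -muleA lee_wpmul2l ?lee_fin ?mulr_ge0//.
rewrite -nneseriesZl; last by move=> k _; rewrite lee_fin exprn_ge0.
apply: (@le_trans _ _ (\sum_(k <oo) mass f (cube (c k) (s k) `&` L))%E).
  apply: lee_nneseries => [k _ _|k _].
    by rewrite mule_ge0// lee_fin ?divr_ge0 ?exprn_ge0// ltW.
  rewrite -EFinM; apply: weak_type_local => //.
  by case: (sP k) => [->|[/rhoP[_ h] ->]]; [left|right].
apply: le_integral_disjoint => //; first exact: measurable_abs_fun.
  move=> i j _ _ [x [[xi _] [xj _]]]; apply: (sdisj i j) => //.
  by exists x.
by move=> x [k _ []].
Qed.

(** Does the work of Lebesgue's differentiation theorem. Low averages on the tripled Vitali cubes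
    inside [U] give [t * mu A <= mass f A <= t / 4 * mu U <= t / 2 * mu A], which is impossible if
    [mu A > 0]; [3 ^ D] absorbs the tripling. *)
Lemma density t : 0 < t -> mu (level t `\` high_avg f (t / (4 * 3 ^+ D))) = 0%E.
Proof.
move=> t0; set A := _ `\` _.
have mA : measurable (A : set (lebT R d.+1)).
  by apply: measurableD; [exact: measurable_level|exact: measurable_high_avg].
have tA : (t%:E * mu A <= mass f A)%E.
  by apply: mass_ge_level => //; [exact: ltW|exact: subDsetl].
have Aoo : (mu A < +oo)%E.
  rewrite ltNge leye_eq; apply/negP => /eqP Aoo.
  move: tA; rewrite Aoo gt0_muley ?lte_fin// => /le_trans/(_ (mass_le_fin mA)).
  by rewrite leye_eq.
apply/eqP; rewrite eq_le lebesgue_outer_ge0 andbT leNgt; apply/negP => A0.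
have Afin : mu A \is a fin_num by rewrite ge0_fin_numE ?lebesgue_outer_ge0.
have m0 : 0 < fine (mu A) by rewrite fine_gt0// A0.
(* The allowed excess is [mu A] itself, hence [mu U <= 2 * mu A]. *)
have [U [oU AU]] := outer_regular Aoo m0.
rewrite fineK// => UA.
have /choice[rho rhoP] : forall x, exists r, A x -> 0 < r <= 1 /\ cube x r `<=` U.
  move=> x; have [Ax|nx] := pselect (A x); last by exists 0.
  have /open_cubeP/(_ _ (AU _ Ax))[r r0 xr] := oU.
  exists (Num.min r 1) => _; split; first by rewrite lt_min r0 ltr01 ge_min lexx orbT.
  by apply: subset_trans xr; apply: sub_cube; rewrite ge_min lexx.
have [|c [s [sP sdisj scov]]] := @vitali_cover _ _ A rho 1.
  by move=> x /rhoP[].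
have s0 k : 0 <= s k by case: (sP k) => [->//|[/rhoP[/andP[/ltW ? _] _] ->]].
have mU : measurable (U : set (lebT R d.+1)) by exact: measurable_open.
have : (mass f A <= (t / 4)%:E * mu U)%E.
  apply: (@le_trans _ _ (\sum_(k <oo) mass f (cube (c k) (3 * s k)))%E).
    apply: le_integral_cover => //; first exact: measurable_abs_fun.
    by move=> k; exact: measurable_cube.
  apply: (@le_trans _ _ (\sum_(k <oo) ((t / 4)%:E * mu (cube (c k) (s k))))%E).
    apply: lee_nneseries => [k _ _|k _]; first exact: mass_ge0.
    case: (sP k) => [sk|[Ack sk]].
      rewrite sk mulr0 cube_le0// mass_set0 mule_ge0 ?lebesgue_outer_ge0//.
      by rewrite lee_fin divr_ge0// ltW.
    have sk0 : 0 < s k by rewrite sk; have [/andP[]] := rhoP _ Ack.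
    have [_ nh] := Ack.
    apply: (@le_trans _ _ (t / (4 * 3 ^+ D) * (3 * s k) ^+ D)%:E).
      rewrite leNgt; apply/negP => h; apply: nh; exists (3 * s k) => //.
      by rewrite mulr_gt0.
    apply: (@le_trans _ _ ((t / 4)%:E * (s k ^+ D)%:E)%E).
      rewrite -EFinM lee_fin exprMn invfM -!mulrA (mulrA (3 ^+ D)^-1).
      by rewrite mulVf ?mul1r// expf_neq0.
    rewrite lee_wpmul2l//; first by rewrite lee_fin divr_ge0// ltW.
    exact: lebesgue_cube_ge.
  rewrite nneseriesZl; last by move=> k _; exact: lebesgue_outer_ge0.
  rewrite lee_wpmul2l//; first by rewrite lee_fin divr_ge0// ltW.
  apply: le_measure_disjoint => //; first by move=> k; exact: measurable_cube.
  move=> x [k _]; case: (sP k) => [->|[/rhoP[_ + ->]]]; last exact.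
  by rewrite cube_le0.
move=> /(le_trans tA).
have t40 : (0 <= (t / 4)%:E)%E by rewrite lee_fin divr_ge0// ltW.
move=> /le_trans/(_ (lee_wpmul2l t40 UA)).
rewrite -(fineK Afin) -EFinD -!EFinM lee_fin.
have : 0 < t * fine (mu A) by rewrite mulr_gt0.
move=> h1 h2; have : t * fine (mu A) <= t * fine (mu A) / 2 by lra.
by move: h1; lra.
Qed.

(* The cube sits inside the Euclidean ball obtained by moving [x] slightly
   towards the centre [a]. *)
Lemma corkscrew (a x : 'rV[R]_d.+1) r s : eclosed_ball a r x -> 0 < s <= 2 * r ->
  exists z, cube z (s / (2 * K)) `<=` cube x s `&` eclosed_ball a r.
Proof.
move=> ax /andP[s0 sr]; have r0 : 0 < r by lra.
pose u := s / (2 * r).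
have u0 : 0 <= u by rewrite divr_ge0 ?mulr_ge0// ltW.
have u1 : 0 <= 1 - u by rewrite subr_ge0 ler_pdivrMr ?mul1r// mulr_gt0.
have ur : u * r = s / 2 by rewrite /u; field; rewrite gt_eqF.
exists (x + u *: (a - x)) => y.
have s2K : 0 < s / (2 * K) by rewrite divr_gt0// mulr_gt0.
move=> /(cube_sub_eball s2K); rewrite /eball/=.
have -> : K * (s / (2 * K)) = s / 2 by rewrite mulrC invfM mulrA divfK ?pnatr_eq0.
set z := x + _ => yz; split.
  apply: eball_sub_cube; rewrite /eball/= -(subrKA z) (le_lt_trans (enormD _ _))//.
  rewrite [ltRHS]splitr ltr_leD// /z addrAC subrr add0r enormZ// -ur ler_wpM2l//.
  by rewrite -[a - x]opprB enormN.
rewrite /eclosed_ball/= -(subrKA z) (le_trans (enormD _ _))//.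
have -> : z - a = (1 - u) *: (x - a).
  by apply/rowP => i; rewrite /z !mxE; ring.
rewrite enormZ//; have := ler_wpM2l u1 ax.
by rewrite [X in _ <= X -> _]mulrBl mul1r ur; move: yz; lra.
Qed.

Lemma reverse_weak_type (a : 'rV[R]_d.+1) r : 0 < r ->
  (forall x, f x != 0 -> eclosed_ball a r x) ->
  exists2 t0, 1 <= t0 & forall t, t0 <= t ->
    (mass f (level t) <= (t * (2 * K) ^+ D)%:E *
      mu (eclosed_ball a r `&` high_avg f (t / (4 * 6 ^+ D))))%E.
Proof.
move=> r0 fB; set B := eclosed_ball a r.
pose c0 : R := (4 * 3 ^+ D)^-1.
have c00 : 0 < c0 by rewrite invr_gt0 mulr_gt0// exprn_gt0.
have N0 : 0 <= N by rewrite fine_ge0// mass_ge0.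
(* Above this threshold [N < c0 * t * r ^ D], so a cube of high average at level [c0 * t] has
   half-side below [r]. *)
exists (1 + N / (c0 * r ^+ D)).
  by rewrite lerDl divr_ge0// mulr_ge0 ?exprn_ge0// ltW.
move=> t tge.
have t1 : 0 < t.
  by rewrite (lt_le_trans _ tge)// ltr_pwDl// divr_ge0// mulr_ge0 ?exprn_ge0// ltW.
have ct : 0 < c0 * t by rewrite mulr_gt0.
have tN : N < c0 * t * r ^+ D.
  rewrite mulrAC mulrC -ltr_pdivrMr ?mulr_gt0 ?exprn_gt0//.
  by apply: lt_le_trans tge; rewrite ltrDr.
have tE : t / (4 * 3 ^+ D) = c0 * t by rewrite mulrC.
pose V := level t `&` high_avg f (c0 * t).
have mV : measurable (V : set (lebT R d.+1)).
  by apply: measurableI; [exact: measurable_level|exact: measurable_high_avg].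
have VB x : V x -> B x.
  by move=> [tx _]; apply: fB; rewrite -normr_gt0 (lt_trans t1).
have mH s : measurable (high_avg f s : set (lebT R d.+1)) by exact: measurable_high_avg.
have mVC : measurable (level t `\` high_avg f (c0 * t) : set (lebT R d.+1)).
  by apply: measurableD => //; exact: measurable_level.
have -> : mass f (level t) = mass f V.
  rewrite /mass -{1}(setUIDK (level t) (high_avg f (c0 * t))).
  rewrite ge0_integral_setU//.
  - rewrite [X in (_ + X)%E]null_set_integral ?adde0//.
    + by apply: measurable_funTS; exact: measurable_abs_fun.
    + by rewrite -tE; exact: density.
  - by apply: measurable_funTS; exact: measurable_abs_fun.
  - by rewrite disj_set2E; apply/eqP; rewrite setDE setIACA setICr setI0.
have /choice[rho rhoP] : forall x, exists s, V x -> [/\ 0 < s < r,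
    ((c0 * t * s ^+ D)%:E < mass f (cube x s))%E &
    (mass f (cube x (3 * s)) <= (c0 * t * (3 * s) ^+ D)%:E)%E].
  move=> x; have [[_ [s1 s10 xs1]]|nx] := pselect (V x); last by exists 0.
  (* A radius in [S] exceeding a third of the supremum has its triple outside [S], which bounds the
     mass of the tripled cube from above. *)
  pose S := [set s | 0 < s /\ ((c0 * t * s ^+ D)%:E < mass f (cube x s))%E].
  have Sr s : S s -> s < r.
    move=> [s0 /lt_le_trans/(_ (mass_le_fin (measurable_cube _ _)))].
    rewrite lte_fin ltNge => h; rewrite ltNge; apply: contra h => rs.
    by rewrite (le_trans (ltW tN))// ler_pM2l// ler_pXn2r// ?nnegrE ?(ltW r0) ?(ltW s0).
  have hsS : has_sup S by split; [exists s1|exists r => s /Sr/ltW].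
  have S0 : 0 < sup S by apply: (lt_le_trans s10); apply: ub_le_sup; [exact: hsS.2|].
  have e0 : 0 < sup S - sup S / 3 by lra.
  have [s [s0 xs] Ss] := sup_adherent e0 hsS.
  exists s => _; split => //; first by rewrite s0 Sr.
  rewrite leNgt; apply/negP => x3s.
  have : S (3 * s) by split => //; rewrite mulr_gt0.
  move=> /(ub_le_sup hsS.2); move: Ss; lra.
have [|c [s [sP sdisj scov]]] := @vitali_cover _ _ V rho r.
  by move=> x /rhoP[/andP[-> /ltW]].
have s0 k : 0 <= s k by case: (sP k) => [->//|[/rhoP[/andP[/ltW ? _] _] _ ->]].
(* Disjoint pieces of the target set; [corkscrew] puts a cube of half-side [s k / (2 * K)] into each
   nonempty Vitali cube and [B], whence the factor [(2 * K) ^ D]. *)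
pose W k := cube (c k) (s k) `&` (B `&` high_avg f (t / (4 * 6 ^+ D))).
have mW k : measurable (W k : set (lebT R d.+1)).
  apply: measurableI; first exact: measurable_cube.
  by apply: measurableI => //; exact: measurable_eclosed_ball.
apply: (@le_trans _ _ (\sum_(k <oo) mass f (cube (c k) (3 * s k)))%E).
  apply: le_integral_cover => //; first exact: measurable_abs_fun.
  by move=> k; exact: measurable_cube.
apply: (@le_trans _ _ (\sum_(k <oo) ((t * (2 * K) ^+ D)%:E * mu (W k)))%E); last first.
  rewrite nneseriesZl; last by move=> k _; exact: lebesgue_outer_ge0.
  rewrite lee_wpmul2l//; first by rewrite lee_fin mulr_ge0 ?exprn_ge0// ltW.
  apply: le_measure_disjoint => //.
  - by apply: measurableI => //; exact: measurable_eclosed_ball.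
  - move=> i j _ _ [x [[xi _] [xj _]]]; apply: (sdisj i j) => //.
    by exists x.
  - by move=> x [k _ []].
apply: lee_nneseries => [k _ _|k _]; first exact: mass_ge0.
case: (sP k) => [sk|[Vck sk]].
  rewrite sk mulr0 cube_le0// mass_set0 mule_ge0 ?lebesgue_outer_ge0//.
  by rewrite lee_fin mulr_ge0 ?exprn_ge0// ltW.
have [/andP[sk0 skr] ck ck3] := rhoP _ Vck; rewrite -sk in sk0 skr ck ck3.
apply: (le_trans ck3).
have [|z zsub] := @corkscrew a (c k) r (s k) (VB _ Vck).
  by rewrite sk0/=; lra.
have s2K : 0 <= s k / (2 * K) by rewrite divr_ge0// mulr_ge0.
apply: (@le_trans _ _ ((t * (2 * K) ^+ D)%:E * ((s k / (2 * K)) ^+ D)%:E)%E).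
  have EK : (2 * K) ^+ D * (s k / (2 * K)) ^+ D = s k ^+ D.
    by rewrite -exprMn mulrC divfK// mulf_neq0// pnatr_eq0.
  rewrite -EFinM lee_fin -[leRHS]mulrA EK.
  have -> : c0 * t * (3 * s k) ^+ D = t * s k ^+ D / 4.
    rewrite exprMn /c0; have : (3 : R) ^+ D != 0 by rewrite expf_neq0.
    by move: (3 ^+ D) => w w0; field.
  by rewrite ler_piMr ?mulr_ge0 ?exprn_ge0 ?(ltW t1)// invf_le1// ler1n.
rewrite lee_wpmul2l//; first by rewrite lee_fin mulr_ge0 ?exprn_ge0// ltW.
apply: le_trans (lebesgue_cube_ge z s2K) _.
apply: le_lebesgue_outer => y /zsub[ycs yB]; split => //; split => //.
(* Doubling the half-side around [y] captures the whole Vitali cube and lowers the level by [2 ^ D]: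
   [c0 * t / 2 ^ D = t / (4 * 6 ^ D)]. *)
exists (2 * s k); first by rewrite mulr_gt0.
apply: (@lt_le_trans _ _ (mass f (cube (c k) (s k)))).
  apply: le_lt_trans ck; rewrite lee_fin exprMn mulrA ler_wpM2r ?exprn_ge0//.
  have -> : (6 : R) ^+ D = 3 ^+ D * 2 ^+ D by rewrite -exprMn -natrM.
  have := @expf_neq0 R 3 D; have := @expf_neq0 R 2 D.
  rewrite /c0; move: (3 ^+ D) (2 ^+ D) => u v.
  rewrite !pnatr_eq0 => /(_ isT) v0 /(_ isT) u0.
  by rewrite le_eqVlt; apply/orP; left; apply/eqP; field; rewrite u0 v0.
apply: mass_sub; [exact: mf|exact: measurable_cube..|].
move=> x xc; have := cube_triangle (cube_sym ycs) xc.
by rewrite mulr_natl mulr2n.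
Qed.

End weak_type.

(** * Sums over exponential levels *)

Section exp_levels.
Context {R : realType}.
Implicit Types (s t : R) (u : nat -> R).
Local Notation e := (expR 1 : R).

(** The sum of [u k] over the levels [e ^ k] below [s]. The argument is extended real because the
    maximal function may be infinite. *)
Definition exp_series u (s : \bar R) : \bar R :=
  (\sum_(k <oo) if (expR k%:R)%:E < s then (u k)%:E else 0)%E.

Lemma exp_bracket s : 1 < s -> exists n, expR n%:R < s <= expR n.+1%:R.
Proof.
move=> s1.
have ex : exists n, s <= expR n.+1%:R.
  exists (Num.truncn s); apply/ltW/(lt_le_trans (truncnS_gt s)).
  by rewrite (le_trans _ (expR_ge1Dx _))// lerDr.
have [n sn nmin] := ex_minnP ex; exists n; rewrite sn andbT.
case: n => [|n] in sn nmin *; first by rewrite expR0.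
by rewrite ltNge; apply/negP => /nmin; rewrite ltnn.
Qed.

Lemma exp_series_bracket u s n : expR n%:R < s <= expR n.+1%:R ->
  (forall k, 0 <= u k) ->
  exp_series u s%:E = (\sum_(0 <= k < n.+1) u k)%:E.
Proof.
move=> /andP[ns sn] u0; rewrite /exp_series (@nneseries_split _ _ 0 n.+1); last first.
  by move=> k _; case: ifPn => // _; rewrite lee_fin.
rewrite add0n [X in (_ + X)%E]eseries0 ?adde0; last first.
  move=> k nk _; rewrite ifF//; apply/negbTE; rewrite -leNgt lee_fin (le_trans sn)//.
  by rewrite ler_expR ler_nat.
rewrite -sumEFin big_nat [in RHS]big_nat; apply: eq_bigr => k /andP[_ kn].
by rewrite lte_fin (le_lt_trans _ ns)// ler_expR ler_nat -ltnS.
Qed.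

Lemma exp_series_le1 u s : s <= 1 -> exp_series u s%:E = 0%E.
Proof.
move=> s1; apply: eseries0 => k _ _; rewrite ifF//; apply/negbTE.
by rewrite -leNgt lee_fin (le_trans s1)// -expR0 ler_expR.
Qed.

Lemma exp_series_ge0 u (s : \bar R) : (forall k, 0 <= u k) -> (0 <= exp_series u s)%E.
Proof.
by move=> u0; apply: nneseries_ge0 => k _ _; case: ifPn => // _; rewrite lee_fin.
Qed.

Definition exp_weight k : R := expR k%:R / k.+1%:R.

Lemma exp_weight_ge0 k : 0 <= exp_weight k.
Proof. by rewrite divr_ge0// expR_ge0. Qed.

Lemma exp_weight_ge1 k : 1 <= exp_weight k.
Proof. by rewrite ler_pdivlMr// mul1r -natr1 addrC expR_ge1Dx. Qed.

(** All weights are at least 1, so the full series diverges; this matches [Psi x +oo = +oo]. *)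
Lemma exp_series_weight_pinfty : exp_series exp_weight +oo%E = +oo%E.
Proof.
apply/eqyP => A A0; pose n := (Num.truncn A).+1.
apply: (@le_trans _ _ (\sum_(0 <= k < n) (exp_weight k)%:E)%E).
  rewrite sumEFin lee_fin (@le_trans _ _ (\sum_(0 <= k < n) 1))//.
    by rewrite sumr_const_nat subn0 ltW// truncnS_gt.
  by apply: ler_sum => k _; exact: exp_weight_ge1.
apply: le_trans (nneseries_lim_ge n _); last first.
  by move=> k _ _; rewrite ltry lee_fin exp_weight_ge0.
by apply: lee_sum => k _; rewrite ltry.
Qed.

Lemma e_ge2 : 2 <= e.
Proof. exact: (expR_ge1Dx 1). Qed.

Lemma ln_e_ge1 s : 0 <= s -> 1 <= ln (e + s).
Proof.
move=> s0; rewrite -{1}(expRK 1) ler_ln ?posrE ?expR_gt0// ?lerDl//.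
by rewrite ltr_pwDl// expR_gt0.
Qed.

(* Up to constants, [exp_series exp_weight s] is [s / ln (e + s)]: on the
   bracket [e^n < s <= e^(n+1)] both are comparable to [e^n / (n + 1)]. *)
Lemma le_exp_series_weight s : 0 <= s ->
  ((s / ln (e + s))%:E <= 1 + (2 * e)%:E * exp_series exp_weight s%:E)%E.
Proof.
move=> s0; have l1 := ln_e_ge1 s0; have l0 := lt_le_trans ltr01 l1.
have [s1|s1] := leP s 1.
  rewrite exp_series_le1// mule0 adde0 lee_fin ler_pdivrMr// mul1r.
  exact: le_trans l1.
have [n /[dup] nP /andP[ns sn]] := exp_bracket s1.
rewrite (exp_series_bracket nP exp_weight_ge0) -EFinM -EFinD lee_fin.
apply: (@le_trans _ _ (2 * e * exp_weight n)); last first.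
  rewrite -[leLHS]add0r lerD// ler_pM2l ?mulr_gt0 ?expR_gt0//.
  by rewrite big_nat_recr//= lerDr sumr_ge0// => k _; exact: exp_weight_ge0.
have ln_n : n%:R <= ln (e + s).
  rewrite -[leLHS]expRK ler_ln ?posrE ?expR_gt0//; last by rewrite ltr_pwDl// expR_gt0.
  by rewrite (le_trans (ltW ns))// lerDr expR_ge0.
have n2 : n.+1%:R <= 2 * ln (e + s) by rewrite -natr1; lra.
rewrite ler_pdivrMr// (le_trans sn)// -natr1 expRD /exp_weight.
have en : 0 < expR n%:R * e by rewrite mulr_gt0 ?expR_gt0.
rewrite (_ : _ * ln _ = expR n%:R * e * (2 * ln (e + s) / n.+1%:R)); last first.
  by field; rewrite addrC natr1 pnatr_eq0.
by rewrite ler_peMr ?(ltW en)// ler_pdivlMr// mul1r.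
Qed.

(** Geometric growth: from index 1 on, consecutive weights have ratio at least
    [2 * (2 / 3) = 4 / 3], and the induction step needs [4 w_n + w_(n+1) <= 4 w_(n+1)]. The step
    from index 0 is done separately. *)
Lemma sum_exp_weight_le n : \sum_(0 <= k < n.+1) exp_weight k <= 4 * exp_weight n.
Proof.
have e2 := e_ge2.
elim: n => [|n ih].
  by rewrite big_nat1 ler_peMl ?exp_weight_ge0// ler1n.
rewrite big_nat_recr//=.
have E : exp_weight n.+1 = e * (n.+1%:R / n.+2%:R) * exp_weight n.
  rewrite /exp_weight -(natr1 n) expRD natr1.
  have := pnatr_eq0 R n.+1; have := pnatr_eq0 R n.+2.
  move: (n.+1%:R) (n.+2%:R) => u v v0 u0.
  by field; rewrite u0 v0.
case: n ih E => [|n] ih E.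
  by rewrite E big_nat1; have := exp_weight_ge0 0; nra.
apply: (le_trans (lerD ih (lexx _))); rewrite E.
have q : 2 / 3 <= (n.+2%:R / n.+3%:R : R).
  have n2 : 2 <= n.+2%:R :> R by rewrite ler_nat.
  by rewrite ler_pdivlMr// -(natr1 n.+2); lra.
have x43 : 4 / 3 <= e * (n.+2%:R / n.+3%:R).
  by apply: le_trans (ler_pM _ _ e2 q); lra.
have := ler_wpM2r (exp_weight_ge0 n.+1) x43.
by move: (e * _) (exp_weight n.+1) => x w; lra.
Qed.

Lemma exp_series_weight_le s : 0 <= s ->
  (exp_series exp_weight s%:E <= (8 * (s / ln (e + s)))%:E)%E.
Proof.
move=> s0; have l1 := ln_e_ge1 s0; have l0 := lt_le_trans ltr01 l1.
have [s1|s1] := leP s 1.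
  by rewrite exp_series_le1// lee_fin mulr_ge0// divr_ge0// ltW.
have [n /[dup] nP /andP[ns sn]] := exp_bracket s1.
rewrite (exp_series_bracket nP exp_weight_ge0) lee_fin.
apply: (le_trans (sum_exp_weight_le n)).
have ln_n : ln (e + s) <= n.+2%:R.
  rewrite -[leRHS]expRK ler_ln ?posrE ?expR_gt0//; last by rewrite ltr_pwDl// expR_gt0.
  rewrite -(natr1 n.+1) expRD.
  have h1 : e <= expR n.+1%:R by rewrite ler_expR ler1n.
  have := expR_gt0 (n.+1%:R : R); have := e_ge2; move: sn h1; nra.
rewrite (_ : 8 * _ = 4 * (2 * s / ln (e + s))); last by field; rewrite gt_eqF.
rewrite ler_pM2l// ler_pdivlMr// /exp_weight mulrAC ler_pdivrMr//.
have h : ln (e + s) <= 2 * n.+1%:R.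
  by rewrite (le_trans ln_n)// -!natr1; have : (0 : R) <= n%:R by []; lra.
have := expR_gt0 (n%:R : R); move: ns h l0; nra.
Qed.

(** Telescoping with [ln (1 + x) <= x] at [x = 1 / (n + 2)]. *)
Lemma harmonic_sum_ge n : ln n.+2%:R <= \sum_(0 <= k < n.+1) k.+1%:R^-1 :> R.
Proof.
elim: n => [|n ih].
  by rewrite big_nat1 invr1 (le_trans (le_ln1Dx _))// ltrN10.
rewrite big_nat_recr//=; apply: le_trans (lerD ih (lexx _)).
rewrite -lerBlDl -ln_div ?posrE//.
have -> : n.+3%:R / n.+2%:R = 1 + n.+2%:R^-1 :> R.
  by rewrite -(natr1 n.+2) mulrDl divff// mul1r.
by rewrite le_ln1Dx// (@lt_trans _ _ 0)// ?ltrN10// invr_gt0.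
Qed.

(** The same inequality at [x = - 1 / (n + 2)]. *)
Lemma harmonic_sum_le n : \sum_(0 <= k < n.+1) k.+1%:R^-1 <= 1 + ln n.+1%:R :> R.
Proof.
elim: n => [|n ih].
  by rewrite big_nat1 invr1 ln1 addr0.
rewrite big_nat_recr//=; apply: (le_trans (lerD ih (lexx _))).
rewrite -addrA lerD2l -lerBrDl -opprB lerNr -ln_div ?posrE//.
have -> : n.+1%:R / n.+2%:R = 1 + - n.+2%:R^-1 :> R.
  by apply/(canLR (mulfK _)); rewrite // mulrBl mul1r mulVf// -(natr1 n.+1) addrK.
by rewrite le_ln1Dx// ltrN2 invf_lt1// ltr1n.
Qed.

Definition harm k : R := k.+1%:R^-1.

Lemma harm_ge0 k : 0 <= harm k. Proof. by rewrite invr_ge0. Qed.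

Lemma lnplus_ge0 t : 0 <= lnplus t.
Proof. by rewrite /lnplus le_max lexx orbT. Qed.

(** On the bracket [e^n < t <= e^(n+1)], [ln (ln t) <= ln (n + 2)], which the harmonic sum
    dominates. *)
Lemma lnplus_lnplus_le t : ((lnplus (lnplus t))%:E <= exp_series harm t%:E)%E.
Proof.
have [t1|t1] := leP t 1.
  rewrite exp_series_le1// (_ : lnplus t = 0); last first.
    by apply/max_idPr; exact: ln_le0.
  by rewrite /lnplus ln0// maxxx.
have [n /[dup] nP /andP[nt tn]] := exp_bracket t1.
rewrite (exp_series_bracket nP harm_ge0) lee_fin.
have t0 : 0 < t by rewrite (lt_trans _ t1).
rewrite ge_max sumr_ge0 ?andbT; last by move=> k _; exact: harm_ge0.
apply: le_trans (harmonic_sum_ge n).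
have lt0 : 0 < ln t by rewrite ln_gt0.
rewrite [lnplus t]max_l ?(ltW lt0)// ler_ln ?posrE//.
rewrite (@le_trans _ _ n.+1%:R) ?ler_nat//.
by rewrite -[leRHS]expRK ler_ln ?posrE ?expR_gt0.
Qed.

Lemma exp_series_harm_le (C : R) : 0 < C -> exists2 c : R, 0 <= c &
  forall t, 0 <= t ->
  (exp_series harm (C * t)%:E <= (c + lnplus (lnplus t))%:E)%E.
Proof.
move=> C0; pose p := `|ln C|.
have p0 : 0 <= p by rewrite normr_ge0.
have lp : 0 <= ln (p + 2) by rewrite ln_ge0//; lra.
exists (1 + ln (p + 2)); first by lra.
move=> t t0.
have LL0 := lnplus_ge0 (lnplus t).
have [Ct1|Ct1] := leP (C * t) 1.
  by rewrite exp_series_le1// lee_fin; lra.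
have {}t0 : 0 < t.
  by rewrite lt_neqAle t0 andbT eq_sym; apply: contraTN Ct1 => /eqP ->; rewrite mulr0 ltNge ler01.
have [n /[dup] nP /andP[nt tn]] := exp_bracket Ct1.
rewrite (exp_series_bracket nP harm_ge0) lee_fin.
apply: (le_trans (harmonic_sum_le n)); rewrite -addrA lerD2l.
have np : n%:R <= p + ln t.
  apply: (@le_trans _ _ (ln C + ln t)); last by rewrite lerD2r ler_norm.
  by rewrite -lnM ?posrE// -[leLHS]expRK ler_ln ?posrE ?expR_gt0 ?mulr_gt0// ltW.
(* From [n + 1 <= p + 1 + ln t]: if [ln t <= 1] this is at most [p + 2], otherwise at most
   [(p + 2) * ln t]. *)
have [lt1|lt1] := leP (ln t) 1.
  apply: (@le_trans _ _ (ln (p + 2))); last by rewrite lerDl.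
  by rewrite ler_ln ?posrE//; [rewrite -natr1; lra|lra].
have l0 : 0 < ln t by rewrite (lt_trans _ lt1).
apply: (@le_trans _ _ (ln (p + 2) + ln (ln t))); last first.
  rewrite lerD2l /lnplus [Num.max (ln t) 0]max_l ?(ltW l0)//.
  by rewrite le_max lexx.
have p20 : 0 < p + 2 by lra.
rewrite -lnM ?posrE// ler_ln ?posrE ?mulr_gt0// -natr1; nra.
Qed.

End exp_levels.

(** * Integration over the levels *)

Section exp_series_integral.
Context {disp} {T : measurableType disp} {R : realType} (mu : {measure set T -> \bar R}).
Implicit Types (A : set T) (u : nat -> R).
Local Open Scope ereal_scope.

(* The library's [ge0_le_integral] asks for measurability of both functions. *)
Lemma le_integral_of_le A (f1 f2 : T -> \bar R) :
  (forall x, A x -> 0 <= f1 x) -> (forall x, A x -> f1 x <= f2 x) ->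
  \int[mu]_(x in A) f1 x <= \int[mu]_(x in A) f2 x.
Proof.
move=> f10 f12; rewrite !(integral_mkcond A) !ge0_integralTE; last 2 first.
- by apply: erestrict_ge0 => x Ax; rewrite (le_trans (f10 _ Ax))// f12.
- exact: erestrict_ge0.
apply: ge_ereal_sup => _ [h hf <-]; apply: ereal_sup_ubound; exists h => // x.
by apply: (le_trans (hf x)); exact: lee_restrict.
Qed.

Variable g : T -> \bar R.
Hypothesis mg : measurable_fun setT g.

Lemma measurable_gt_set (c : \bar R) : measurable [set x | c < g x].
Proof. by have := emeasurable_fun_o_infty measurableT mg c; rewrite setTI. Qed.

(** A discrete layer-cake formula, by exchanging sum and integral. It is used with [phi = |f|] and
    with [phi = 1]. *)
Lemma integral_exp_series A u (phi : T -> R) : measurable A ->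
  (forall k, (0 <= u k)%R) -> measurable_fun setT phi -> (forall x, (0 <= phi x)%R) ->
  \int[mu]_(x in A) ((phi x)%:E * exp_series u (g x)) =
  \sum_(k <oo) (u k)%:E * \int[mu]_(x in A `&` [set x | (expR k%:R)%:E < g x]) (phi x)%:E.
Proof.
move=> mA u0 mphi phi0.
pose h k x := (u k)%:E * ((EFin \o phi) \_ [set x | (expR k%:R)%:E < g x]) x.
have mE k : measurable [set x | (expR k%:R)%:E < g x] by exact: measurable_gt_set.
have mh0 k : measurable_fun A ((EFin \o phi) \_ [set x | (expR k%:R)%:E < g x]).
  apply: measurable_funTS; apply/(measurable_restrictT _ (mE k)).1.
  by apply: measurable_funTS; exact/measurable_EFinP.
have h0 k x : 0 <= ((EFin \o phi) \_ [set x | (expR k%:R)%:E < g x]) x.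
  by apply: erestrict_ge0 => y _; rewrite lee_fin.
transitivity (\int[mu]_(x in A) \sum_(k <oo) h k x).
  apply: eq_integral => x _; rewrite /exp_series -nneseriesZl; last first.
    by move=> k _; case: ifPn => // _; rewrite lee_fin.
  apply: eq_eseriesr => k _; rewrite /h patchE.
  have -> : (x \in [set x | (expR k%:R)%:E < g x]) = ((expR k%:R)%:E < g x).
    by apply/idP/idP; rewrite inE.
  by case: ifPn => _; rewrite ?mule0//= muleC.
rewrite integral_nneseries//; last 2 first.
- by move=> k; exact: measurable_funeM.
- by move=> k x _; rewrite mule_ge0// lee_fin.
apply: eq_eseriesr => k _.
by rewrite ge0_integralZl_EFin// integral_mkcondr.
Qed.

Lemma integral_exp_series1 A u : measurable A -> (forall k, (0 <= u k)%R) ->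
  \int[mu]_(x in A) exp_series u (g x) =
  \sum_(k <oo) (u k)%:E * mu (A `&` [set x | (expR k%:R)%:E < g x]).
Proof.
move=> mA u0.
transitivity (\int[mu]_(x in A) ((cst 1%R x)%:E * exp_series u (g x))).
  by apply: eq_integral => x _; rewrite mul1e.
rewrite integral_exp_series//; apply: eq_eseriesr => k _.
rewrite (eq_integral (cst 1))// integral_cst ?mul1e//.
by apply: measurableI => //; exact: measurable_gt_set.
Qed.

Lemma measurable_exp_series A u : (forall k, (0 <= u k)%R) -> measurable A ->
  measurable_fun A (fun x => exp_series u (g x)).
Proof.
move=> u0 mA; apply: measurable_funTS.
apply: (@ge0_emeasurable_sum _ _ _ _ _ xpredT) => [k x _ _|k _].
  by case: ifPn => // _; rewrite lee_fin.
have -> : (fun x => if (expR k%:R)%:E < g x then (u k)%:E else 0) =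
    (cst (u k)%:E) \_ [set x | (expR k%:R)%:E < g x].
  apply/funext => x; rewrite patchE.
  have -> // : (x \in [set x | (expR k%:R)%:E < g x]) = ((expR k%:R)%:E < g x).
  by apply/idP/idP; rewrite inE.
by apply/(measurable_restrictT _ (measurable_gt_set _)).1.
Qed.

End exp_series_integral.

(** * The two implications for a function supported in a closed ball *)

Section main.
Context {R : realType} {d : nat}.
Local Notation mu := (@lebesgue R d.+1).
Local Notation K := (d.+2%:R : R).
Local Notation D := d.+1.
Variables (a : 'rV[R]_d.+1) (r : R).
Hypothesis r0 : 0 < r.
Local Notation B := (eclosed_ball a r).
Variable f : lebT R d.+1 -> R.
Hypothesis mf : measurable_fun setT f.
Hypothesis fB : forall x, f x != 0 -> B x.

Let mB : measurable (B : set (lebT R d.+1)).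
Proof. exact: measurable_eclosed_ball. Qed.

Lemma mass_support (A : set 'rV[R]_d.+1) : B `<=` A -> mass f A = mass f B.
Proof.
move=> BA; rewrite /mass integral_mkcond [RHS]integral_mkcond.
apply: eq_integral => x _; rewrite !patchE.
have [xB|xB] := boolP (x \in B).
  by rewrite ifT// inE; apply: BA; rewrite inE in xB.
case: ifPn => // _; have [->|/fB] := eqVneq (f x) 0; first by rewrite abse0.
by move=> Bx; rewrite mem_set in xB.
Qed.

Lemma compact_eclosed_ball : compact B.
Proof.
have := @compact_box _ _ (\row_i (a ord0 i - r)) (\row_i (a ord0 i + r)).
move/(subclosed_compact (@closed_eclosed_ball _ _ a r)); apply => x ax i.
rewrite !mxE -ler_distlC distrC.
by have := le_trans (coord_le_enorm (x - a) i) ax; rewrite !mxE.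
Qed.

Lemma lebesgue_eclosed_ball_lty : (mu B < +oo)%E.
Proof.
apply: (@le_lt_trans _ _ (mu (eball a (2 * r)))).
  apply: le_lebesgue_outer => x; rewrite /eclosed_ball/eball/=.
  by move=> h; apply: (le_lt_trans h); rewrite mulr_natl mulr2n ltrDl.
by rewrite (le_lt_trans (lebesgue_eball_le a _)) ?ltry// mulr_ge0// ltW.
Qed.

Lemma lebesgue_eclosed_ball_gt0 : (0 < mu B)%E.
Proof.
apply: (@lt_le_trans _ _ (mu (eball a r))).
  rewrite (lt_le_trans _ (lebesgue_eball_ge a r0))// lte_fin exprn_gt0// divr_gt0//.
by apply: le_lebesgue_outer => x; exact: ltW.
Qed.

Lemma Psi_ge0 (x : 'rV[R]_d.+1) (t : \bar R) : (0 <= t -> 0 <= Psi x t)%E.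
Proof.
case: t => [s|//|//]; rewrite /= !lee_fin => s0.
have l1 := ln_e_ge1 s0; have l2 := ln_e_ge1 (enorm_ge0 x).
by rewrite divr_ge0//; lra.
Qed.

Lemma Psi_le_exp_series (x : 'rV[R]_d.+1) (t : \bar R) : (0 <= t)%E ->
  (Psi x t <= 1 + (2 * expR 1)%:E * exp_series exp_weight t)%E.
Proof.
case: t => [s|_|//]; last first.
  by rewrite exp_series_weight_pinfty gt0_muley ?addey// lte_fin mulr_gt0// expR_gt0.
rewrite lee_fin => s0; apply: le_trans (le_exp_series_weight s0).
rewrite /= lee_fin ler_wpM2l//.
have l1 := ln_e_ge1 s0; have l2 := ln_e_ge1 (enorm_ge0 x).
by rewrite lef_pV2 ?posrE//; lra.
Qed.

Lemma exp_series_le_Psi (C : R) : 1 <= C -> exists2 L : R, 0 < L &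
  forall x (t : \bar R), B x -> (0 <= t)%E ->
  (L%:E * exp_series exp_weight (C%:E * t) <= Psi x t)%E.
Proof.
move=> C1; pose l := ln (expR 1 + (r + enorm a)).
have ra0 : 0 <= r + enorm a by rewrite addr_ge0 ?enorm_ge0// ltW.
have l1 : 1 <= l by exact: ln_e_ge1.
exists (8 * C * (1 + l))^-1; first by rewrite invr_gt0; nra.
move=> x [s|_|//] Bx; last by rewrite leey.
rewrite lee_fin => s0; rewrite -EFinM.
have Cs0 : 0 <= C * s by nra.
apply: (@le_trans _ _ ((8 * C * (1 + l))^-1%:E * (8 * (C * s / ln (expR 1 + C * s)))%:E)%E).
  by rewrite lee_wpmul2l ?exp_series_weight_le// lee_fin invr_ge0; nra.
rewrite -EFinM /= lee_fin.
have m1 := ln_e_ge1 Cs0; have m2 := ln_e_ge1 s0; have m3 := ln_e_ge1 (enorm_ge0 x).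
have e0 : 0 < expR 1 :> R by rewrite expR_gt0.
have m12 : ln (expR 1 + s) <= ln (expR 1 + C * s).
  by rewrite ler_ln ?posrE; nra.
have m3l : ln (expR 1 + enorm x) <= l.
  rewrite ler_ln ?posrE; [|have := enorm_ge0 x; lra|lra].
  by rewrite lerD2l -(subrK a x) (le_trans (enormD _ _))// lerD2r.
move: m1 m2 m3 m12 m3l; move: (ln _) (ln _) (ln _) => w q p p1 q1 w1 qp wl.
have -> : (8 * C * (1 + l))^-1 * (8 * (C * s / p)) = s / ((1 + l) * p).
  by field; apply/and3P; split; apply: lt0r_neq0; lra.
rewrite ler_wpM2l// lef_pV2 ?posrE; nra.
Qed.

(** The ball of radius [3 * r] around [x] contains [B], so infinite mass would make its average
    infinite. *)
Lemma mass_lty_of_maximal (x : 'rV[R]_d.+1) : B x -> (maximal f x < +oo)%E ->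
  (mass f setT < +oo)%E.
Proof.
move=> Bx Mx; rewrite (mass_support (@subsetT _ _)).
have r3 : 0 < 3 * r by rewrite mulr_gt0.
have BE : B `<=` eball x (3 * r).
  move=> y By; rewrite /eball/= -(subrKA a) (le_lt_trans (enormD _ _))//.
  rewrite -[enorm (a - x)]enormN opprB.
  apply: (@le_lt_trans _ _ (r + r)); first exact: lerD.
  by rewrite -(natr1 2) mulrDl mul1r mulr_natl mulr2n ltrDl.
rewrite -(mass_support BE) ltNge leye_eq; apply/negP => /eqP E.
have Mfin : maximal f x \is a fin_num by rewrite ge0_fin_numE ?maximal_ge0.
have [m xm _] := lebesgue_eball x r3.
have : ((fine (maximal f x))%:E < maximal f x)%E.
  by apply/maximal_gtP; exists (3 * r) => //; rewrite (eball_average_gt f _ r3 xm) E ltry.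
by rewrite fineK// ltxx.
Qed.

(** Otherwise the maximal function, hence [Psi], is infinite on all of [B], a set of positive
    measure. *)
Lemma mass_lty_of_L_Psi : L_Psi B (maximal f) -> (mass f setT < +oo)%E.
Proof.
move=> [_ h]; apply: contrapT => nfin; move: h.
rewrite (eq_integral (cst +oo%E)); last first.
  move=> x; rewrite inE => Bx.
  suff -> : maximal f x = +oo%E by [].
  by apply/eqP; rewrite -leye_eq leNgt; apply/negP => /(mass_lty_of_maximal Bx).
by rewrite integral_cst// gt0_mulye ?lebesgue_eclosed_ball_gt0.
Qed.

Let mabs : measurable_fun setT (fun x : lebT R d.+1 => `|f x|).
Proof. by apply: measurableT_comp => //; exact: normr_measurable. Qed.

Let mMf : measurable_fun setT (maximal f : lebT R d.+1 -> \bar R).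
Proof. exact: measurable_maximal. Qed.

Lemma LloglogL_of_L_Psi : L_Psi B (maximal f) ->
  (\int[mu]_(x in B) (`|f x| * lnplus (lnplus `|f x|))%:E < +oo)%E.
Proof.
move=> LP; have fin := mass_lty_of_L_Psi LP; have [_ Plty] := LP.
have [t0 t01 rev] := reverse_weak_type mf fin r0 fB.
pose N := fine (mass f setT).
have NE : N%:E = mass f setT by rewrite fineK// ge0_fin_numE ?mass_ge0.
(* From index [m] on, [e ^ k >= k >= m > t0], so [rev] applies. *)
pose m := (Num.truncn t0).+1.
have tm k : (m <= k)%N -> t0 <= expR k%:R.
  move=> mk; apply: (@le_trans _ _ m%:R); first exact/ltW/truncnS_gt.
  by rewrite (le_trans _ (expR_ge1Dx _))// (@le_trans _ _ k%:R) ?ler_nat// lerDr.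
(* The losses of [reverse_weak_type] and [high_avg_maximal] combined: a high average at level
   [e ^ k / (4 * 6 ^ D)] forces [C * maximal f x > e ^ k]. *)
pose C : R := 4 * 6 ^+ D * (2 * K) ^+ D.
have C1 : 1 <= C.
  have h1 : 1 <= 6 ^+ D :> R by rewrite exprn_ege1// ler1n.
  have h2 : 1 <= (2 * K) ^+ D by rewrite exprn_ege1// -natrM ler1n.
  by rewrite /C; move: h1 h2; nra.
have C0 : 0 < C by rewrite (lt_le_trans _ C1).
pose g x := (C%:E * maximal f x)%E.
have mg : measurable_fun setT (g : lebT R d.+1 -> \bar R) by exact: measurable_funeM.
pose W k := B `&` [set x | ((expR k%:R)%:E < g x)%E].
have mW k : measurable (W k : set (lebT R d.+1)).
  by apply: measurableI => //; exact: (measurable_gt_set mg).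
pose S := (\sum_(k <oo) (exp_weight k)%:E * mu (W k))%E.
have Slty : (S < +oo)%E.
  have [L L0 LPsi] := exp_series_le_Psi C1.
  have : (L%:E * S < +oo)%E.
    apply: le_lt_trans Plty.
    rewrite /S -(integral_exp_series1 mu mg)//; last exact: exp_weight_ge0.
    have mE : measurable_fun (B : set (lebT R d.+1)) (fun x => exp_series exp_weight (g x)).
      by apply: (measurable_exp_series mg) => //; exact: exp_weight_ge0.
    have es0 x : (0 <= exp_series exp_weight (g x))%E.
      by apply: exp_series_ge0; exact: exp_weight_ge0.
    rewrite -ge0_integralZl_EFin ?(ltW L0)//.
    apply: le_integral_of_le => x Bx; first by rewrite mule_ge0// lee_fin ltW.
    by rewrite gee0_abs ?maximal_ge0// LPsi ?maximal_ge0.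
  rewrite ltNge leye_eq => h; rewrite ltNge leye_eq.
  by apply: contra h => /eqP ->; rewrite gt0_muley ?lte_fin.
(* Term by term: the finitely many levels below [m] are bounded by the total mass, the others by the
   reverse weak type inequality. *)
apply: (@le_lt_trans _ _ (\sum_(k <oo) ((if (k < m)%N then N%:E else 0) +
    ((2 * K) ^+ D)%:E * ((exp_weight k)%:E * mu (W k))))%E); last first.
  have w0 k : (0 <= (exp_weight k)%:E * mu (W k))%E.
    by rewrite mule_ge0// lee_fin exp_weight_ge0.
  have K0 : 0 <= (2 * K) ^+ D by rewrite exprn_ge0.
  have N0 : 0 <= N by rewrite fine_ge0// mass_ge0.
  rewrite nneseriesD; last 2 first.
  - by move=> k _ _; case: ifPn; rewrite ?lee_fin.
  - by move=> k _ _; rewrite mule_ge0.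
  rewrite nneseriesZl//; apply: lte_add_pinfty; last first.
    by rewrite -/S; apply: lte_mul_pinfty => //; rewrite lee_fin.
  rewrite (@nneseries_split _ _ 0 m); last by move=> k _; case: ifPn; rewrite ?lee_fin.
  rewrite add0n [X in (_ + X)%E]eseries0 ?adde0; last first.
    by move=> k mk _; rewrite ltnNge mk.
  rewrite (eq_bigr (fun k => (if (k < m)%N then N else 0)%:E)); last by move=> k _; case: ifPn.
  by rewrite sumEFin ltry.
apply: (@le_trans _ _ (\int[mu]_(x in B) (`|f x|%:E * exp_series harm (`|f x|%:E)))%E).
  apply: le_integral_of_le => x _.
    by rewrite lee_fin mulr_ge0// lnplus_ge0.
  by rewrite EFinM lee_wpmul2l ?lee_fin// lnplus_lnplus_le.
have mgf : measurable_fun setT (EFin \o (fun x : lebT R d.+1 => `|f x|)).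
  exact/measurable_EFinP.
rewrite (integral_exp_series mu mgf)//; last exact: harm_ge0.
apply: lee_nneseries => [k _ _|k _].
  by rewrite mule_ge0 ?integral_ge0// lee_fin ?harm_ge0.
have harm1 : harm k <= 1 :> R by rewrite /harm invf_le1// ler1n.
have mL : measurable (level f (expR k%:R) : set (lebT R d.+1)) by exact: measurable_level.
apply: (@le_trans _ _ ((harm k)%:E * mass f (level f (expR k%:R)))%E).
  rewrite lee_wpmul2l ?lee_fin ?harm_ge0//.
  by apply: mass_sub => [//|||x []//]; first exact: measurableI.
have [km|mk] := ltnP k m.
  apply: (@le_trans _ _ N%:E); last first.
    rewrite leeDl// mule_ge0 ?lee_fin ?exprn_ge0// mule_ge0//.
    by rewrite lee_fin exp_weight_ge0.
  rewrite NE -[leRHS]mul1e; apply: lee_pmul; rewrite ?lee_fin ?harm_ge0 ?mass_ge0//.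
  exact: mass_sub.
rewrite add0e; apply: (@le_trans _ _ ((harm k)%:E * ((expR k%:R * (2 * K) ^+ D)%:E *
    mu (B `&` high_avg f (expR k%:R / (4 * 6 ^+ D)))))%E).
  by rewrite lee_wpmul2l ?lee_fin ?harm_ge0// rev// tm.
rewrite muleA -EFinM muleA -EFinM.
(* The two weights differ exactly by the level: [exp_weight k = harm k * e ^ k]. *)
rewrite (_ : harm k * _ = (2 * K) ^+ D * exp_weight k); last first.
  by rewrite mulrCA mulrA mulrC.
rewrite lee_wpmul2l//; first by rewrite lee_fin mulr_ge0 ?exprn_ge0 ?exp_weight_ge0.
apply: le_lebesgue_outer => x [Bx hx]; split => //=.
rewrite /g -lte_pdivrMl// -EFinM; apply: high_avg_maximal => //.
  by rewrite mulr_ge0 ?invr_ge0 ?expR_ge0// ltW.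
rewrite (_ : _ * _ = expR k%:R / (4 * 6 ^+ D))//.
have : (2 * K) ^+ D != 0 by rewrite expf_neq0// mulf_neq0// pnatr_eq0.
have : (6 : R) ^+ D != 0 by rewrite expf_neq0.
by rewrite /C; move: ((6 : R) ^+ D) ((2 * K) ^+ D) => u v u0 v0; field; rewrite u0 v0.
Qed.

Lemma L_Psi_of_LloglogL : (mass f setT < +oo)%E ->
  (\int[mu]_(x in B) (`|f x| * lnplus (lnplus `|f x|))%:E < +oo)%E ->
  L_Psi B (maximal f).
Proof.
move=> fin LLL; split; first exact: measurable_maximal.
(* [K ^ D] is lost in [maximal_high_avg] and [2 ^ (D + 1)] in the truncation of [weak_type]. *)
pose C : R := K ^+ D * 2 ^+ d.+2.
have C0 : 0 < C by rewrite mulr_gt0// exprn_gt0.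
have [c c0 cP] := exp_series_harm_le C0.
pose g (x : lebT R d.+1) : \bar R := (C * `|f x|)%:E.
have mg : measurable_fun setT g.
  by apply/measurable_EFinP; apply: measurable_funM.
have K0 : 0 <= K ^+ D * (2 * 6 ^+ D) by rewrite mulr_ge0// ?mulr_ge0 ?exprn_ge0.
(* The constant [C] costs only an additive [c], whose contribution [c * |f|] is integrable because
   the mass is finite. *)
have fin1 : (\int[mu]_(x in B) (`|f x|%:E * exp_series harm (g x)) < +oo)%E.
  apply: (@le_lt_trans _ _ (\int[mu]_(x in B) (c%:E * `|f x|%:E +
      (`|f x| * lnplus (lnplus `|f x|))%:E)))%E.
    apply: le_integral_of_le => x _.
      by rewrite mule_ge0// exp_series_ge0//; exact: harm_ge0.
    rewrite -EFinM -EFinD mulrC -mulrDr EFinM lee_wpmul2l//.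
    exact: cP.
  have mabsE : measurable_fun (B : set (lebT R d.+1)) (fun x => `|f x|%:E).
    by apply: measurable_funTS; exact/measurable_EFinP.
  rewrite ge0_integralD//.
  - apply: lte_add_pinfty => //; rewrite ge0_integralZl_EFin//.
    apply: lte_mul_pinfty; rewrite ?lee_fin//.
    by apply: le_lt_trans fin; exact: (mass_sub mf).
  - by move=> x _; rewrite mule_ge0.
  - exact: measurable_funeM.
  - by move=> x _; rewrite lee_fin mulr_ge0// lnplus_ge0.
  - apply: measurable_funTS; apply/measurable_EFinP; apply: measurable_funM => //.
    have ml : measurable_fun setT (@lnplus R).
      by apply: measurable_maxr => //; exact: measurable_ln.
    by apply: measurableT_comp => //; apply: measurableT_comp.
pose S := (\int[mu]_(x in B) exp_series exp_weight (maximal f x))%E.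
have Slty : (S < +oo)%E.
  apply: (@le_lt_trans _ _ ((K ^+ D * (2 * 6 ^+ D))%:E *
      \int[mu]_(x in B) (`|f x|%:E * exp_series harm (g x)))%E); last first.
    by apply: lte_mul_pinfty; rewrite ?lee_fin.
  rewrite (integral_exp_series mu mg)//; last exact: harm_ge0.
  rewrite /S (integral_exp_series1 mu mMf)//; last exact: exp_weight_ge0.
  have mL t : measurable (level f t : set (lebT R d.+1)) by exact: measurable_level.
  rewrite -nneseriesZl; last first.
    by move=> k _; rewrite mule_ge0 ?integral_ge0// lee_fin harm_ge0.
  apply: lee_nneseries => [k _ _|k _].
    by rewrite mule_ge0// lee_fin exp_weight_ge0.
  pose t : R := expR k%:R / K ^+ D.
  have t0 : 0 < t by rewrite divr_gt0 ?expR_gt0// exprn_gt0.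
  apply: (@le_trans _ _ ((exp_weight k)%:E * mu (high_avg f t))%E).
    rewrite lee_wpmul2l ?lee_fin ?exp_weight_ge0//.
    apply: le_lebesgue_outer => x [_ /=]; exact: maximal_high_avg (expR_ge0 _).
  have -> : exp_weight k = harm k * K ^+ D * t.
    have : K ^+ D != 0 by rewrite expf_neq0.
    rewrite /exp_weight /harm /t; move: (K ^+ D) => u u0.
    by rewrite mulrA -(mulrA _ u) [u * _]mulrC mulrA mulfK// mulrC.
  rewrite EFinM -muleA.
  apply: (@le_trans _ _ ((harm k * K ^+ D)%:E * ((2 * 6 ^+ D)%:E *
      mass f (level f (t / 2 ^+ d.+2))))%E).
    rewrite lee_wpmul2l ?lee_fin ?mulr_ge0 ?harm_ge0 ?exprn_ge0//.
    exact: weak_type.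
  rewrite muleA -EFinM [leRHS]muleA -EFinM.
  rewrite (_ : harm k * K ^+ D * _ = K ^+ D * (2 * 6 ^+ D) * harm k); last first.
    by rewrite -mulrA mulrC.
  rewrite lee_wpmul2l ?lee_fin ?mulr_ge0 ?harm_ge0 ?exprn_ge0//.
  apply: mass_sub => //.
    by apply: measurableI => //; exact: (measurable_gt_set mg).
  move=> x; rewrite /level/= => tx; split.
    apply: fB; rewrite -normr_gt0; apply: lt_trans tx.
    by rewrite divr_gt0// exprn_gt0.
  rewrite /= lte_fin mulrC -ltr_pdivrMr//.
  by move: tx; rewrite /t /C -mulrA -invfM.
apply: (@le_lt_trans _ _ (\int[mu]_(x in B) (1%:E + (2 * expR 1)%:E *
    exp_series exp_weight (maximal f x)))%E).
  apply: le_integral_of_le => x _; first by rewrite Psi_ge0.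
  by rewrite gee0_abs ?maximal_ge0// Psi_le_exp_series// maximal_ge0.
have e0 : 0 <= 2 * expR 1 :> R by rewrite mulr_ge0// expR_ge0.
have mE : measurable_fun (B : set (lebT R d.+1)) (fun x => exp_series exp_weight (maximal f x)).
  by apply: (measurable_exp_series mMf) => //; exact: exp_weight_ge0.
have es0 x : (0 <= exp_series exp_weight (maximal f x))%E.
  by apply: exp_series_ge0; exact: exp_weight_ge0.
rewrite ge0_integralD//; [|by move=> x _; rewrite mule_ge0|exact: measurable_funeM].
rewrite integral_cst// mul1e; apply: lte_add_pinfty; first exact: lebesgue_eclosed_ball_lty.
by rewrite ge0_integralZl_EFin//; apply: lte_mul_pinfty; rewrite ?lee_fin.
Qed.

End main.

Theorem theorem1 (R : realType) (d : nat) (d_gt0 : (0 < d)%N)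
    (a : 'rV[R]_d) (r : R) (r_gt0 : 0 < r) (B : set 'rV[R]_d)
    (B_ball : B = eclosed_ball a r) (B_proper : B `<` [set: 'rV[R]_d])
    (f : lebT R d -> R) (mf : measurable_fun setT f)
    (f_supp : supp f `<=` B) :
  L_Psi B (maximal f) <-> LloglogL B f.
Proof.
case: d d_gt0 a B B_ball B_proper f mf f_supp => // d _ a _ -> _ f mf f_supp.
have fB x : f x != 0 -> eclosed_ball a r x by move=> fx; apply/f_supp/subset_closure.
split=> [LP|[[_ Lloc] _ LLL]].
  (* Finite total mass gives local integrability. *)
  have fin := mass_lty_of_L_Psi r_gt0 fB LP.
  split => //; last exact: LloglogL_of_L_Psi.
  split => // K cK; apply: le_lt_trans fin; apply: (mass_sub mf) => //.
  by apply: measurable_closed; apply: compact_closed => //; exact: norm_hausdorff.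
apply: L_Psi_of_LloglogL => //.
(* All the mass sits on the compact ball, where local integrability makes it finite. *)
by rewrite (mass_support fB (@subsetT _ _)); apply: Lloc; exact: compact_eclosed_ball.
Qed.
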